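(* Let $d\ge1$, let $\Pi$ be a translation-invariant simple point process on $\mathbb{R}^d$ with intensity $\lambda\in(0,\infty)$ and law $\mathbf{P}$, and let $\alpha\in(0,\infty)$. Then $\mathbf{P}$-a.s. there exists an $\mathcal{L}$-a.e. unique stable allocation $\Psi_\Pi$ of $\mathbb{R}^d$ to $\Xi=[\Pi]$ with appetite $\alpha$ (i.e. $\mathbf{P}$-a.s. a stable allocation exists and any two stable allocations agree $\mathcal{L}$-a.e.). Furthermore, $\Psi_\Pi$ can be chosen to be a measurable, isometry-equivariant factor of $\Pi$; that is, there exists an isometry-equivariant factor allocation $\Psi_\bullet$ such that $\Psi_\Pi$ is $\mathbf{P}$-a.s. a stable allocation to $[\Pi]$ with appetite $\alpha$.
   Context: $|\cdot|$ is the Euclidean norm and $\mathcal{L}$ is Lebesgue measure (volume) on $\mathbb{R}^d$. Elements of $\mathbb{R}^d$ are called sites. Let $\Xi\subset\mathbb{R}^d$ be discrete (every bounded subset of $\mathbb{R}^d$ contains only finitely many of its elements); elements of $\Xi$ are called centers. An allocation of $\mathbb{R}^d$ to $\Xi$ with appetite $\alpha$ is a measurable function $\psi:\mathbb{R}^d\to\Xi\cup\{\infty,\Delta\}$ (where $\infty,\Delta$ are two extra symbols) such that $\mathcal{L}[\psi^{-1}(\Delta)]=0$ and $\mathcal{L}[\psi^{-1}(\xi)]\le\alpha$ for all $\xi\in\Xi$. The set $\psi^{-1}(\xi)$ is the territory of $\xi$. A center $\xi$ is sated if $\mathcal{L}[\psi^{-1}(\xi)]=\alpha$ and unsated otherwise.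 A site $x$ is claimed if $\psi(x)\in\Xi$ and unclaimed if $\psi(x)=\infty$. Stability: let $\xi$ be a center and $x$ a site with $\psi(x)\notin\{\xi,\Delta\}$. We say $x$ desires $\xi$ if $|x-\xi|<|x-\psi(x)|$ or $x$ is unclaimed. We say $\xi$ covets $x$ if $|x-\xi|<|x'-\xi|$ for some $x'\in\psi^{-1}(\xi)$, or $\xi$ is unsated. The pair $(x,\xi)$ is unstable for $\psi$ if $x$ desires $\xi$ and $\xi$ covets $x$. An allocation is stable if there are no unstable pairs. Point processes: for a simple point measure $\pi$, $[\pi]=\{z\in\mathbb{R}^d:\pi(\{z\})=1\}$ is its support. The intensity of $\Pi$ is its mean number of points per unit volume; finite intensity implies $[\Pi]$ is a.s. discrete. A factor allocation is a measurable map $\Psi_\bullet$ (meaning $(\pi,x)\mapsto\Psi_\pi(x)$ is measurable) assigning to $\mathbf{P}$-a.e. point measure $\pi$ an allocation $\Psi_\pi$ to $[\pi]$, which is translation-equivariant: for every translation $T$ of $\mathbb{R}^d$, if $\Psi_\pi(x)=\xi$ then $\Psi_{T\pi}(Tx)=T\xi$ (with $T\infty=\infty$, $T\Delta=\Delta$, and with $\Psi_{T\pi}$ defined if and only if $\Psi_\pi$ is). It is isometry-equivariant if this holds for all isometries $T$ of $\mathbb{R}^d$. *)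

(* Defs.v *)
From HB Require Import structures.
From mathcomp Require Import all_boot all_order all_algebra.
From mathcomp Require Import all_classical all_reals all_analysis.
From mathcomp Require Import measurable_realfun ring.

Set Implicit Arguments.
Unset Strict Implicit.
Unset Printing Implicit Defensive.

Import Order.TTheory GRing.Theory Num.Theory.
Import numFieldNormedType.Exports.

Local Open Scope classical_set_scope.
Local Open Scope ring_scope.
Local Open Scope ereal_scope.

(* R^d is 'rV[R]_d. The library norm on matrices is the sup norm, hence the
   separate Euclidean norm. *)
Definition enorm (R : realType) (d : nat) (x : 'rV[R]_d) : R :=
  Num.sqrt (\sum_(i < d) x ord0 i ^+ 2)%R.

Definition edist (R : realType) (d : nat) (x y : 'rV[R]_d) : R :=
  enorm (x - y)%R.

(* The sigma-algebra generated by the coordinates is the Borel sigma-algebra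
   of R^d. *)
Definition euclidean_display : measure_display.
Proof. by constructor. Qed.

Section euclidean_measurable.
Context (R : realType) (d : nat).

Let coord (i : 'I_d) (x : 'rV[R]_d) : R := x ord0 i.

Let rV0 : g_sigma_preimage coord set0.
Proof. exact: sigma_algebra0. Qed.

Let rVC A : g_sigma_preimage coord A -> g_sigma_preimage coord (~` A).
Proof. exact: sigma_algebraC. Qed.

Let rVU (F : (set 'rV[R]_d)^nat) : (forall i, g_sigma_preimage coord (F i)) ->
  g_sigma_preimage coord (\bigcup_i (F i)).
Proof. exact: sigma_algebra_bigcup. Qed.

HB.instance Definition _ := @isMeasurable.Build euclidean_display
  'rV[R]_d (g_sigma_preimage coord) rV0 rVC rVU.

Lemma measurable_coord (i : 'I_d) :
  measurable_fun [set: 'rV[R]_d] (fun x : 'rV[R]_d => x ord0 i).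
Proof.
move=> _ Y mY; rewrite setTI; apply: sub_sigma_algebra => /=.
rewrite -bigcup_seq/=; exists i => /=; first by rewrite mem_index_enum.
by exists Y => //; rewrite setTI.
Qed.

Lemma measurable_rV (disp : measure_display) (T : measurableType disp)
    (f : T -> 'rV[R]_d) :
  (forall i, measurable_fun [set: T] (fun t => f t ord0 i)) ->
  measurable_fun [set: T] f.
Proof.
move=> mf.
have : g_sigma_preimage (fun i => coord i \o f) `<=` measurable.
  apply: smallest_sub; first exact: sigma_algebra_measurable.
  rewrite -bigcup_seq/=; apply: bigcup_sub => i _.
  by move=> A [B mB <-]; exact: mf.
rewrite g_sigma_preimage_comp => pref _ A mA.
by apply: pref; exists A.
Qed.

End euclidean_measurable.

Section lebesgue.
Context (R : realType).

Definition consrV (d : nat) (p : 'rV[R]_d * R) : 'rV[R]_d.+1 :=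
  \row_(i < d.+1) oapp (fun j => p.1 ord0 j) p.2 (unlift ord0 i).

Lemma measurable_consrV (d : nat) :
  measurable_fun [set: 'rV[R]_d * R] (@consrV d).
Proof.
apply: measurable_rV => i; rewrite /consrV.
under eq_fun do rewrite mxE.
case: unliftP => [j|] _ /=; last exact: measurable_snd.
exact: (measurableT_comp (@measurable_coord R d j) measurable_fst).
Qed.

Definition lebesgueS (d : nat) (m : {measure set 'rV[R]_d -> \bar R}) :=
  pushforward (m \x lebesgue_measure) (@consrV d).

Section lebesgueS_measure.
Context (d : nat) (m : {measure set 'rV[R]_d -> \bar R}).

Let lebesgueS0 : lebesgueS m set0 = 0.
Proof. by rewrite /lebesgueS /pushforward preimage_set0 measure0. Qed.

Let lebesgueS_ge0 A : 0 <= lebesgueS m A.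
Proof. by rewrite /lebesgueS /pushforward measure_ge0. Qed.

Let lebesgueS_sigma_additive : semi_sigma_additive (lebesgueS m).
Proof.
move=> F mF tF mUF.
exact: (@measure_semi_sigma_additive _ _ _
  (measure_function_pushforward__canonical__measure_function_Measure
     (m \x lebesgue_measure) (@measurable_consrV d)) F mF tF mUF).
Qed.

HB.instance Definition _ := isMeasure.Build _ _ _ (lebesgueS m)
  lebesgueS0 lebesgueS_ge0 lebesgueS_sigma_additive.

End lebesgueS_measure.

(* Lebesgue measure on (the Borel sets of) R^d, as the d-fold product of
   Lebesgue measure on R. *)
Fixpoint lebesgue (d : nat) : {measure set 'rV[R]_d -> \bar R} :=
  match d with
  | 0 => dirac (0%R : 'rV[R]_0)
  | d'.+1 => lebesgueS (lebesgue d')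
  end.

End lebesgue.

Section isometry.
Context (R : realType) (d : nat).

Record isometry := Isometry {
  isometry_fun :> 'rV[R]_d -> 'rV[R]_d ;
  edist_isometry : forall x y,
    edist (isometry_fun x) (isometry_fun y) = edist x y }.

Implicit Types (T : isometry) (x y v : 'rV[R]_d).

Let dot x y : R := (\sum_(i < d) x ord0 i * y ord0 i)%R.

Let enorm2 x : (enorm x ^+ 2 = dot x x)%R.
Proof.
rewrite /enorm sqr_sqrtr; last by apply: sumr_ge0 => i _; exact: sqr_ge0.
by apply: eq_bigr => i _; rewrite expr2.
Qed.

Let polar x y : (dot x y *+ 2 = dot x x + dot y y - dot (x - y) (x - y))%R.
Proof.
rewrite /dot -!big_split/= -sumrMnl -sumrB; apply: eq_bigr => i _.
by rewrite !mxE; ring.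
Qed.

Let edist2 x y : (edist x y ^+ 2 = dot (x - y) (x - y))%R.
Proof. exact: enorm2. Qed.

Lemma edist_eq0 x y : edist x y = 0%R -> x = y.
Proof.
move=> xy0; have : dot (x - y) (x - y) = 0%R by rewrite -edist2 xy0 expr0n.
move/eqP; rewrite psumr_eq0 => [/allP h|i _]; last first.
  by rewrite -expr2 sqr_ge0.
apply/rowP => i; have := h i (mem_index_enum _); rewrite !mxE /= mulf_eq0.
by rewrite orbb subr_eq0 => /eqP.
Qed.

Lemma isometry_inj T : injective T.
Proof.
move=> x y Txy; apply: edist_eq0; rewrite -(edist_isometry T) Txy.
by rewrite /edist /enorm subrr big1 ?sqrtr0// => i _; rewrite mxE expr0n.
Qed.

Lemma isometry_affine T :
  exists2 U : 'M[R]_d, (U *m U^T)%R = 1%:M%R & forall x, (T x = x *m U + T 0)%R.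
Proof.
pose g x := (T x - T 0)%R.
have gdot x y : dot (g x) (g y) = dot x y.
  have h a : dot (g a) (g a) = dot a a.
    by rewrite -edist2 edist_isometry edist2 subr0.
  have := polar (g x) (g y); rewrite !h.
  have -> : (g x - g y = T x - T y)%R.
    by rewrite /g; apply/rowP => i; rewrite !mxE; ring.
  rewrite -edist2 edist_isometry edist2 -polar => /eqP.
  by rewrite eqrMn2r /= => /eqP.
pose e i : 'rV[R]_d := delta_mx ord0 i.
pose U : 'M[R]_d := \matrix_(i, j) g (e i) ord0 j.
have dote x j : dot x (e j) = x ord0 j.
  rewrite /dot (bigD1 j)//= big1 => [|i /negPf ij].
    by rewrite /e mxE !eqxx mulr1 addr0.
  by rewrite /e mxE ij andbF mulr0.
have UU : (U *m U^T)%R = 1%:M%R.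
  apply/matrixP => i j; rewrite !mxE.
  transitivity (dot (g (e i)) (g (e j))).
    by apply: eq_bigr => k _; rewrite !mxE.
  by rewrite gdot dote /e mxE eqxx /= eq_sym.
exists U => // x.
suff -> : (x *m U)%R = g x by rewrite /g subrK.
have : (g x *m U^T)%R = x.
  apply/rowP => j; rewrite mxE.
  transitivity (dot (g x) (g (e j))).
    by apply: eq_bigr => k _; rewrite !mxE.
  by rewrite gdot dote.
by move=> {1}<-; rewrite -mulmxA (mulmx1C UU) mulmx1.
Qed.

Lemma measurable_isometry T : measurable_fun [set: 'rV[R]_d] T.
Proof.
have [U _ TE] := isometry_affine T.
apply: measurable_rV => i; under eq_fun do rewrite TE !mxE.
apply: measurable_funD; last exact: measurable_cst.
apply: measurable_sum => j.
by apply: measurable_funM; [exact: measurable_coord|exact: measurable_cst].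
Qed.

Lemma edist_translation v x y : edist (x + v) (y + v) = edist x y.
Proof. by rewrite /edist opprD addrACA subrr addr0. Qed.

Definition translation v : isometry := Isometry (edist_translation v).

End isometry.

Section simple_point_measure.
Context (R : realType) (d : nat).

(* A countable sum of unit masses at distinct points. Local finiteness is not
   imposed; a point process of finite intensity satisfies it almost surely. The
   formula is required for all sets A, not only the measurable ones, so that
   the measure is determined by its atoms. *)
Record simple_point_measure := SimplePointMeasure {
  spm_measure :> {measure set 'rV[R]_d -> \bar R} ;
  spm_simple : exists2 S : set 'rV[R]_d, countable S &
    forall A, spm_measure A = \esum_(z in S) \d_z A }.

Definition spm_support (pi : simple_point_measure) : set 'rV[R]_d :=
  [set z | pi [set z] = 1].

Let spm0_simple : exists2 S : set 'rV[R]_d, countable S &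
  forall A, (@mzero _ 'rV[R]_d R) A = \esum_(z in S) \d_z A.
Proof. by exists set0 => // A; rewrite esum_set0. Qed.

HB.instance Definition _ := gen_eqMixin simple_point_measure.
HB.instance Definition _ := gen_choiceMixin simple_point_measure.
HB.instance Definition _ := isPointed.Build simple_point_measure
  (SimplePointMeasure spm0_simple).

Definition spm_measurable : set_system simple_point_measure :=
  <<s \bigcup_(B in [set B : set 'rV[R]_d | measurable B])
        preimage_set_system [set: simple_point_measure]
          (fun pi : simple_point_measure => pi B) measurable >>.

Let spm_measurable0 : spm_measurable set0.
Proof. exact: sigma_algebra0. Qed.

Let spm_measurableC A : spm_measurable A -> spm_measurable (~` A).
Proof. exact: sigma_algebraC. Qed.

Let spm_measurableU (F : (set simple_point_measure)^nat) :
  (forall i, spm_measurable (F i)) -> spm_measurable (\bigcup_i F i).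
Proof. exact: sigma_algebra_bigcup. Qed.

Definition spm_display : measure_display.
Proof. by constructor. Qed.

HB.instance Definition _ := @isMeasurable.Build spm_display
  simple_point_measure spm_measurable
  spm_measurable0 spm_measurableC spm_measurableU.

Section image.
Context (T : isometry R d) (pi : simple_point_measure).

Let image_measure : {measure set 'rV[R]_d -> \bar R} :=
  measure_function_pushforward__canonical__measure_function_Measure
    pi (measurable_isometry T).

Let image_simple : exists2 S : set 'rV[R]_d, countable S &
  forall A, image_measure A = \esum_(z in S) \d_z A.
Proof.
have [S cS piE] := spm_simple pi.
exists (T @` S); first exact: (sub_countable (card_image_le _ _)).
move=> A; rewrite esum_image; last by move=> x y _ _; exact: isometry_inj.
by rewrite /= /pushforward piE; apply: eq_esum => z _; rewrite !diracE.
Qed.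

Definition spm_image : simple_point_measure := SimplePointMeasure image_simple.

Lemma spm_imageE A : spm_image A = pi (T @^-1` A).
Proof. by []. Qed.

End image.

Definition translation_invariant
    (P : probability simple_point_measure R) : Prop :=
  forall (v : 'rV[R]_d) (A : set simple_point_measure), measurable A ->
    P (spm_image (translation v) @^-1` A) = P A.

Definition unit_cube : set 'rV[R]_d :=
  [set x | forall i, (0 <= x ord0 i < 1)%R].

(* For a translation-invariant law, any other set of unit volume gives the same
   value. *)
Definition intensity (P : probability simple_point_measure R) : \bar R :=
  \int[P]_pi (pi : simple_point_measure) unit_cube.

End simple_point_measure.

(* The disjoint union of R^d and of the two symbols oo and Delta. *)
Inductive assignment (R : realType) (d : nat) :=
| Center of 'rV[R]_d
| Infty
| Delta.
Arguments Center {R d}.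
Arguments Infty {R d}.
Arguments Delta {R d}.

Section assignment.
Context (R : realType) (d : nat).
Local Notation assignment := (assignment R d).

HB.instance Definition _ := gen_eqMixin assignment.
HB.instance Definition _ := gen_choiceMixin assignment.
HB.instance Definition _ := isPointed.Build assignment Infty.

(* The disjoint-union sigma-algebra: {oo} and {Delta} are measurable. *)
Definition assignment_measurable : set_system assignment :=
  [set A | measurable (Center @^-1` A : set 'rV[R]_d)].

Let assignment_measurable0 : assignment_measurable set0.
Proof. by rewrite /assignment_measurable/= preimage_set0. Qed.

Let assignment_measurableC A :
  assignment_measurable A -> assignment_measurable (~` A).
Proof. by move=> mA; exact: measurableC. Qed.

Let assignment_measurableU (F : (set assignment)^nat) :
  (forall i, assignment_measurable (F i)) ->
  assignment_measurable (\bigcup_i F i).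
Proof.
move=> mF; rewrite /assignment_measurable/= preimage_bigcup.
exact: bigcupT_measurable.
Qed.

Definition assignment_display : measure_display.
Proof. by constructor. Qed.

HB.instance Definition _ := @isMeasurable.Build assignment_display
  assignment assignment_measurable
  assignment_measurable0 assignment_measurableC assignment_measurableU.

Definition assignment_map (T : 'rV[R]_d -> 'rV[R]_d) (a : assignment) :
    assignment :=
  match a with
  | Center xi => Center (T xi)
  | Infty => Infty
  | Delta => Delta
  end.

End assignment.

Section allocation.
Context (R : realType) (d : nat).
Implicit Types (alpha : R) (Xi : set 'rV[R]_d) (x xi : 'rV[R]_d)
  (psi : 'rV[R]_d -> assignment R d).

Definition locally_finite Xi : Prop :=
  forall B : set 'rV[R]_d,
    (exists r : R, forall x, B x -> (enorm x <= r)%R) -> finite_set (Xi `&` B).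

Definition territory psi xi : set 'rV[R]_d := psi @^-1` [set Center xi].

Record is_allocation alpha Xi psi : Prop := {
  allocation_discrete : locally_finite Xi ;
  allocation_measurable : measurable_fun [set: 'rV[R]_d] psi ;
  allocation_center : forall x xi, psi x = Center xi -> Xi xi ;
  allocation_Delta : lebesgue R d (psi @^-1` [set Delta]) = 0 ;
  allocation_appetite : forall xi, Xi xi ->
    lebesgue R d (territory psi xi) <= alpha%:E }.

Definition sated alpha psi xi : Prop :=
  lebesgue R d (territory psi xi) = alpha%:E.

Definition desires psi x xi : Prop :=
  psi x = Infty \/
  exists2 eta, psi x = Center eta & (edist x xi < edist x eta)%R.

Definition covets alpha psi xi x : Prop :=
  ~ sated alpha psi xi \/
  exists2 x', territory psi xi x' & (edist x xi < edist x' xi)%R.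

Definition unstable_pair alpha Xi psi x xi : Prop :=
  [/\ Xi xi, psi x <> Center xi, psi x <> Delta,
      desires psi x xi & covets alpha psi xi x].

Definition is_stable_allocation alpha Xi psi : Prop :=
  is_allocation alpha Xi psi /\
  forall x xi, ~ unstable_pair alpha Xi psi x xi.

End allocation.

Section factor.
Context (R : realType) (d : nat).
Local Notation spm := (simple_point_measure R d).
Implicit Types (D : set spm) (Psi : spm -> 'rV[R]_d -> assignment R d).

(* Psi pi is considered only for pi in the domain of definition D. *)
Definition equivariant D Psi (T : isometry R d) : Prop :=
  (forall pi, D (spm_image T pi) <-> D pi) /\
  (forall pi, D pi -> forall x,
    Psi (spm_image T pi) (T x) = assignment_map T (Psi pi x)).

(* Measurability of D is required explicitly: measurable_fun on a
   non-measurable domain is vacuous. *)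
Record is_factor_allocation (P : probability spm R) (alpha : R) D Psi : Prop :=
  { factor_measurable_domain : measurable D ;
    factor_domain : P D = 1 ;
    factor_allocation : forall pi, D pi ->
      is_allocation alpha (spm_support pi) (Psi pi) ;
    factor_measurable : measurable_fun (D `*` [set: 'rV[R]_d])
      (fun p : spm * 'rV[R]_d => Psi p.1 p.2) ;
    factor_translation : forall v, equivariant D Psi (translation v) }.

Definition isometry_equivariant D Psi : Prop :=
  forall T : isometry R d, equivariant D Psi T.

End factor.

(* Main.v *)
(* A stable allocation is encoded by its radii: a center xi accepts the sites at
   distance less than r xi, and each site goes to its nearest accepting center.
   Given the radii of the others, the sites still available to xi form a set
   avail r xi s inside the ball of radius s, and r must be chosen so that
   s |-> leb (avail r xi s) reaches alpha exactly at s = r xi (or never exceeds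
   alpha if r xi = +oo). Taking the largest such radius, or the smallest, gives
   two operators that are monotone in r, since larger radii leave fewer sites to
   the others. Iterating the first from +oo yields rmax, a fixed point because
   spheres are null, hence a stable allocation. Iterating the second from 0
   yields rmin, and the radii of every stable allocation lie between rmin and
   rmax.

   With rmax every site is served at least as near as with rmin, while every
   center receives at least as much mass from each ball around it with rmin as
   with rmax. For a translation-invariant law the mass transport principle
   equates the expected mass sent from a ball with the expected mass received in
   it, so both comparisons are almost surely equalities, and all stable
   allocations agree almost everywhere. The radii are built from the centers by
   isometry-invariant measurable operations, so rmax defines the factor. *)
Require Import Defs.
From HB Require Import structures.
From mathcomp Require Import all_boot all_order all_algebra finmap.
From mathcomp Require Import all_classical all_reals all_analysis.
From mathcomp Require Import perm measurable_realfun ring lra.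
(* [all_analysis] has its own [edist]. *)
Import Defs.
Import Order.TTheory GRing.Theory Num.Theory.
Import numFieldNormedType.Exports.

Set Implicit Arguments.
Unset Strict Implicit.
Unset Printing Implicit Defensive.

Local Open Scope classical_set_scope.
Local Open Scope ring_scope.
Local Open Scope ereal_scope.

(** * Measure theory and Lebesgue measure on R^d *)

(** Acceptance is strict, so the volume available to a center is left continuous in its radius;
    right continuity, and the passage to the limit of the decreasing iterates, rest on spheres being
    null, which is where dimension at least one enters. Ties between centers are absorbed by null
    bisectors.

    For a fixed set of centers the argument only sandwiches every stable allocation between two
    extremes; their coincidence comes from the law. The comparison is made for one distance [t] at a
    time, through the volume of sites served within [t] inside a window [Q]. Its expectation is at
    most the volume of [Q], so it is finite and can be subtracted, and rational distances suffice to
    recover the distance at which a site is served.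

    Measurability in the point measure has its own obstacle: a condition of the form
    [some center satisfies E] is a projection. It is rewritten as a nonzero mass of a section, and
    masses of sections are measurable once the point measure is locally finite. *)

Lemma measurable_preimageT d1 d2 (X : measurableType d1) (Y : measurableType d2)
    (f : X -> Y) (C : set Y) :
  measurable_fun setT f -> measurable C -> measurable (f @^-1` C).
Proof. by move=> mf mC; rewrite -[X in measurable X]setTI; exact: mf. Qed.

Lemma measurable_ltr_set disp (T : measurableType disp) (R : realType)
    (f g : T -> R) : measurable_fun setT f -> measurable_fun setT g ->
  measurable [set t | (f t < g t)%R].
Proof.
move=> mf mg; rewrite -[X in measurable X]setTI.
exact: (measurable_fun_ltr mf mg measurableT (_ : measurable [set true])).
Qed.

Lemma sfinite_fubini_set d1 d2 (X : measurableType d1) (Y : measurableType d2)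
    (R : realType) (m1 : {sfinite_measure set X -> \bar R})
    (m2 : {sfinite_measure set Y -> \bar R}) (E : set (X * Y)) :
  measurable E ->
  \int[m1]_x m2 [set y | E (x, y)] = \int[m2]_y m1 [set x | E (x, y)].
Proof.
move=> mE.
have mI : measurable_fun setT (fun p => (\1_E p)%:E : \bar R).
  by apply: measurableT_comp => //; exact: measurable_indic.
have I0 p : 0 <= (\1_E p)%:E :> \bar R by rewrite lee_fin.
have := sfinite_Fubini m1 m2 _ I0 mI.
under eq_integral => x _.
  rewrite (_ : (fun y => _) = EFin \o \1_[set y | E (x, y)]); last first.
    by apply/funext => y; rewrite /= !indicE; congr (_%:R%:E); apply: asbool_equiv_eq.
  rewrite integral_indic ?setIT//; last first.
    have := measurable_xsection x mE; congr measurable.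
    by apply/seteqP; split => y; rewrite /xsection/= inE.
  over.
move=> ->; apply: eq_integral => y _.
rewrite (_ : (fun x => _) = EFin \o \1_[set x | E (x, y)]); last first.
  by apply/funext => x; rewrite /= !indicE; congr (_%:R%:E); apply: asbool_equiv_eq.
rewrite integral_indic ?setIT//.
have := measurable_ysection y mE; congr measurable.
by apply/seteqP; split => x; rewrite /ysection/= inE.
Qed.

Lemma ge0_integral_indic_cst d1 (X : measurableType d1) (R : realType)
    (m : {measure set X -> \bar R}) (A : set X) (c : \bar R) (f : X -> \bar R) :
  measurable A -> 0 <= c -> (forall x, A x -> f x = c) ->
  (forall x, ~ A x -> f x = 0) -> \int[m]_x f x = m A * c.
Proof.
move=> mA c0 fA fNA.
rewrite (eq_integral (fun x => (\1_A x)%:E * c)); last first.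
  move=> x _; rewrite indicE; case: (boolP (x \in A)) => [|/negP]; rewrite inE => Ax.
    by rewrite mul1e fA.
  by rewrite mul0e fNA.
rewrite ge0_integralZr//.
  by rewrite integral_indic// setIT.
by apply: measurableT_comp => //; exact: measurable_indic.
Qed.

Lemma mule_cancelr (R : realType) (x y c : \bar R) :
  c \is a fin_num -> 0 < c -> x * c = y * c -> x = y.
Proof.
move=> cf c0 h; apply/le_anti.
by rewrite -(lee_pmul2r cf c0) h lexx /= -(lee_pmul2r cf c0) h.
Qed.

Section sigma_finite_bundle.
Context d (T : measurableType d) (R : realType) (mu : {measure set T -> \bar R})
  (sf : sigma_finite setT mu).

(** Lets a measure whose sigma-finiteness is only a hypothesis enter Fubini's theorem. It serves for
    the image of Lebesgue measure under an isometry and for a single locally finite point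
    measure. *)
Definition sigma_finite_copy (A : set T) : \bar R := mu A.

Let copy0 : sigma_finite_copy set0 = 0. Proof. exact: measure0. Qed.
Let copy_ge0 A : 0 <= sigma_finite_copy A. Proof. exact: measure_ge0. Qed.
Let copy_sigma_additive : semi_sigma_additive sigma_finite_copy.
Proof. exact: measure_semi_sigma_additive. Qed.

HB.instance Definition _ := isMeasure.Build _ _ _ sigma_finite_copy
  copy0 copy_ge0 copy_sigma_additive.

HB.instance Definition _ := Measure_isSigmaFinite.Build _ _ _ sigma_finite_copy sf.

Lemma sigma_finite_bundle :
  exists m : {sigma_finite_measure set T -> \bar R}, forall A, m A = mu A.
Proof. by exists sigma_finite_copy. Qed.

End sigma_finite_bundle.

Section euclidean_distance.
Context (R : realType) (d : nat).
Implicit Types x y z v : 'rV[R]_d.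

Lemma edist_ge0 x y : (0 <= edist x y)%R.
Proof. exact: sqrtr_ge0. Qed.

Lemma edistxx x : edist x x = 0%R.
Proof.
by rewrite /edist /enorm subrr big1 ?sqrtr0// => i _; rewrite mxE expr0n.
Qed.

Lemma edistC x y : edist x y = edist y x.
Proof.
by congr Num.sqrt; apply: eq_bigr => i _; rewrite !mxE -sqrrN opprB.
Qed.

Lemma enorm_sqr x : (enorm x ^+ 2 = \sum_(i < d) x ord0 i ^+ 2)%R.
Proof. by rewrite sqr_sqrtr// sumr_ge0// => i _; exact: sqr_ge0. Qed.

Lemma edist_sqr x y : (edist x y ^+ 2 = \sum_(i < d) (x ord0 i - y ord0 i) ^+ 2)%R.
Proof. by rewrite enorm_sqr; apply: eq_bigr => i _; rewrite !mxE. Qed.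

Lemma enormD_sqr_le x y : (enorm (x + y) ^+ 2 <= (enorm x ^+ 2 + enorm y ^+ 2) *+ 2)%R.
Proof.
rewrite !enorm_sqr -big_split/= -sumrMnl; apply: ler_sum => i _.
rewrite !mxE -subr_ge0 (_ : _ - _ = (x ord0 i - y ord0 i) ^+ 2)%R ?sqr_ge0//.
by rewrite !expr2 mulr2n; ring.
Qed.

(* The factor 2 avoids the triangle inequality; only boundedness is needed. *)
Lemma enormD_le x y : (enorm (x + y) <= 2 * (enorm x + enorm y))%R.
Proof.
have x0 : (0 <= enorm x)%R by exact: sqrtr_ge0.
have y0 : (0 <= enorm y)%R by exact: sqrtr_ge0.
rewrite -(@ler_pXn2r _ 2)// ?nnegrE ?sqrtr_ge0//; last by nra.
by apply: (le_trans (enormD_sqr_le x y)); nra.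
Qed.

Lemma coord_le_enorm x i : (`|x ord0 i| <= enorm x)%R.
Proof.
rewrite -(@ler_pXn2r _ 2)// ?nnegrE ?sqrtr_ge0// real_normK ?num_real//.
by rewrite enorm_sqr (bigD1 i)//= lerDl sumr_ge0// => j _; exact: sqr_ge0.
Qed.

Lemma edist0 x : edist x 0 = enorm x.
Proof. by rewrite /edist subr0. Qed.

Lemma enormN x : enorm (- x) = enorm x.
Proof. by congr Num.sqrt; apply: eq_bigr => i _; rewrite mxE sqrrN. Qed.

Lemma measurable_edist disp (T : measurableType disp) (f g : T -> 'rV[R]_d) :
  measurable_fun setT f -> measurable_fun setT g ->
  measurable_fun setT (fun t => edist (f t) (g t)).
Proof.
move=> mf mg.
have msqrt : measurable_fun setT (@Num.sqrt R).
  by apply: continuous_measurable_fun; exact: sqrt_continuous.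
apply: (measurableT_comp msqrt).
apply: measurable_sum => i; under eq_fun do rewrite !mxE.
apply: measurable_funX; apply: measurable_funB.
- exact: (measurableT_comp (@measurable_coord R d i) mf).
- exact: (measurableT_comp (@measurable_coord R d i) mg).
Qed.

Lemma measurable_addrV disp (T : measurableType disp) (f g : T -> 'rV[R]_d) :
  measurable_fun setT f -> measurable_fun setT g ->
  measurable_fun setT (fun t => f t + g t)%R.
Proof.
move=> mf mg; apply: measurable_rV => i; under eq_fun do rewrite !mxE.
apply: measurable_funD.
- exact: (measurableT_comp (@measurable_coord R d i) mf).
- exact: (measurableT_comp (@measurable_coord R d i) mg).
Qed.

Lemma measurable_opprV disp (T : measurableType disp) (f : T -> 'rV[R]_d) :
  measurable_fun setT f -> measurable_fun setT (fun t => - f t)%R.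
Proof.
move=> mf; apply: measurable_rV => i; under eq_fun do rewrite !mxE.
exact: measurableT_comp (measurableT_comp (@measurable_coord R d i) mf).
Qed.

Definition eball (z : 'rV[R]_d) (s : R) : set 'rV[R]_d := [set x | (edist x z < s)%R].

Lemma measurable_eball z s : measurable (eball z s).
Proof.
apply: measurable_ltr_set; last exact: measurable_cst.
exact: (measurable_edist (@measurable_id _ _ setT) (measurable_cst z)).
Qed.

Lemma eball_cover z : \bigcup_n eball z n%:R = setT.
Proof.
apply/seteqP; split => // x _; exists (Num.Def.archi_bound (edist x z)) => //=.
exact: archi_boundP (edist_ge0 x z).
Qed.

End euclidean_distance.

Section lebesgue_theory.
Context (R : realType).

Lemma lebesgueSE d (A : set 'rV[R]_d.+1) :
  lebesgue R d.+1 A =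
  \int[lebesgue R d]_x lebesgue_measure [set t | A (consrV (x, t))].
Proof.
rewrite /= /lebesgueS /pushforward /product_measure1; apply: eq_integral => x _ /=.
by congr lebesgue_measure; apply/seteqP; split => t; rewrite /xsection/= inE.
Qed.

Lemma consrV0 d (x : 'rV[R]_d) t : consrV (x, t) ord0 ord0 = t.
Proof. by rewrite mxE unlift_none. Qed.

Lemma consrV_lift d (x : 'rV[R]_d) t i : consrV (x, t) ord0 (lift ord0 i) = x ord0 i.
Proof. by rewrite mxE liftK. Qed.

Lemma measurable_section_consrV d (A : set 'rV[R]_d.+1) (x : 'rV[R]_d) :
  measurable A -> measurable [set t : measurableTypeR R | A (consrV (x, t))].
Proof.
move=> mA; have := @measurable_consrV R d measurableT A mA; rewrite setTI.
move=> /(measurable_xsection x); congr measurable.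
by apply/seteqP; split => t; rewrite /xsection/= inE.
Qed.

Lemma measurable_fun_section_consrV d (A : set 'rV[R]_d.+1) : measurable A ->
  measurable_fun [set: 'rV[R]_d]
    (fun x => lebesgue_measure [set t : measurableTypeR R | A (consrV (x, t))]).
Proof.
move=> mA; have := @measurable_consrV R d measurableT A mA; rewrite setTI => mA'.
apply: (eq_measurable_fun _ _ (measurable_fun_xsection lebesgue_measure mA')) => x _.
by congr lebesgue_measure; apply/seteqP; split => t; rewrite /xsection/= inE.
Qed.

Definition cube d (n : nat) : set 'rV[R]_d :=
  [set x | forall i, (- n%:R <= x ord0 i <= n%:R)%R].

Lemma measurable_cube d n : measurable (@cube d n).
Proof.
rewrite [X in measurable X](_ : _ = \bigcap_(i in [set: 'I_d])
    ((fun x : 'rV[R]_d => x ord0 i) @^-1` `[(- n%:R)%R, n%:R]%classic)); last first.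
  by apply/seteqP; split => x /= h i; [move=> _|]; have := h i; rewrite /= in_itv/=; [|exact].
apply: fin_bigcap_measurable => // i _.
by rewrite -[X in measurable X]setTI; apply: measurable_coord.
Qed.

Lemma lebesgue_cube d n : lebesgue R d (@cube d n) < +oo.
Proof.
elim: d => [|d ih]; first by rewrite /= diracE; case: (_ \in _); rewrite ltry.
rewrite lebesgueSE.
rewrite (@ge0_integral_indic_cst _ _ _ (lebesgue R d) (@cube d n)
    (lebesgue_measure (`[(- n%:R)%R, n%:R]%classic : set R)))//; first last.
- move=> x xb; rewrite [X in lebesgue_measure X](_ : _ = set0) ?measure0//.
  rewrite -subset0 => t /= h; apply: xb => j.
  by have := h (lift ord0 j); rewrite consrV_lift.
- move=> x xb; congr lebesgue_measure; apply/seteqP; split => t /=.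
    by move=> /(_ ord0); rewrite consrV0 in_itv.
  rewrite in_itv /= => h i; have [j ->|->] := unliftP ord0 i; last by rewrite consrV0.
  by rewrite consrV_lift; exact: xb.
- exact: measurable_cube.
rewrite lte_mul_pinfty//; first by rewrite ge0_fin_numE.
rewrite (lebesgue_measure_itv `[(- n%:R)%R, n%:R]) /= lte_fin.
by case: ifP => _; rewrite ?ltry.
Qed.

Lemma eball_lty d (z : 'rV[R]_d) s : lebesgue R d (eball z s) < +oo.
Proof.
(* By [enormD_le] a site of the ball has norm at most [2 * (s + enorm z)], hence coordinates of
   absolute value below [n + n]. *)
set n := Num.Def.archi_bound (s + enorm z).
apply: le_lt_trans (lebesgue_cube d (n + n)%N); rewrite le_measure ?inE//=.
- exact: measurable_eball.
- exact: measurable_cube.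
move=> x /= xz i.
have xn : (enorm x <= 2 * (s + enorm z))%R.
  have -> : x = (x - z + z)%R by rewrite subrK.
  apply: le_trans (enormD_le _ _) _; rewrite ler_pM2l// lerD2r.
  exact: ltW.
have e0 : (0 <= enorm x)%R by exact: sqrtr_ge0.
have sz : (0 <= s + enorm z)%R by lra.
have := archi_boundP sz; rewrite -/n => nsz.
by rewrite natrD -ler_norml; apply: (le_trans (coord_le_enorm x i)); lra.
Qed.

Section leb.
Context (d : nat).

(* A copy of [lebesgue R d] carrying a canonical sigma-finite structure, which
   Fubini's theorem needs. *)
Definition leb (A : set 'rV[R]_d) : \bar R := lebesgue R d A.

Let leb0 : leb set0 = 0. Proof. exact: measure0. Qed.
Let leb_ge0 A : 0 <= leb A. Proof. exact: measure_ge0. Qed.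
Let leb_sigma_additive : semi_sigma_additive leb.
Proof. exact: measure_semi_sigma_additive. Qed.

HB.instance Definition _ := isMeasure.Build _ _ _ leb leb0 leb_ge0 leb_sigma_additive.

Let leb_sigma_finite : sigma_finite setT leb.
Proof.
exists (fun n => eball 0 n%:R); first by rewrite eball_cover.
by move=> n; split; [exact: measurable_eball|exact: eball_lty].
Qed.

HB.instance Definition _ := Measure_isSigmaFinite.Build _ _ _ leb leb_sigma_finite.

End leb.

Lemma leb_setT d : leb [set: 'rV[R]_d] != 0.
Proof.
rewrite /leb; elim: d => [|d ih]; first by rewrite [lebesgue R 0 _]diracT eqe oner_eq0.
rewrite lebesgueSE.
under eq_integral => x _.
  rewrite (_ : [set t | _] = `]-oo, +oo[%classic); last by rewrite set_itvE.
  rewrite lebesgue_measure_itv /=.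
  over.
rewrite integral_cst//= gt0_mulye ?eqe//.
by rewrite lt0e ih measure_ge0.
Qed.

Lemma leb_eball_neq0 d : exists n, leb (eball (0 : 'rV[R]_d) n%:R) != 0.
Proof.
apply: contrapT => /forallNP h; have /negP := leb_setT d; apply.
rewrite -(eball_cover 0); apply/eqP/measure_negligible; last first.
  apply: negligible_bigcup => n; apply/negligibleP; first exact: measurable_eball.
  by apply/eqP; apply: contra_notT (h n).
by apply: bigcupT_measurable => n; exact: measurable_eball.
Qed.

(** Uniqueness of Lebesgue measure from its values on half-open intervals, applied to the image
    under the shift. *)
Lemma lebesgue_measure_translation (c : R) (A : set (measurableTypeR R)) :
  measurable A ->
  lebesgue_measure ((fun t => t + c)%R @^-1` A) = lebesgue_measure A.
Proof.
move=> mA.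
have mc : measurable_fun setT (fun t : measurableTypeR R => t + c : measurableTypeR R)%R.
  by apply: measurable_funD => //; exact: measurable_id.
pose m := measure_function_pushforward__canonical__measure_function_Measure
  (@lebesgue_measure R) mc.
apply/esym/(@lebesgue_measure_unique R m) => //= _ [[a b]] _ <-.
rewrite /pushforward [X in _ = _ X](_ : _ = `](a - c)%R, (b - c)%R]%classic).
  by rewrite !lebesgue_measure_itv/= !lte_fin ltrD2r -!EFinD opprB addrA subrK.
by apply/seteqP; split => t /=; rewrite !in_itv/= ltrBlDr lerBrDr.
Qed.

(** The nullity criterion for spheres and bisectors: a line parallel to the first axis meets them in
    at most two points, respectively one. *)
Lemma leb_null_sections d (A : set 'rV[R]_d.+1) : measurable A ->
  (forall x : 'rV[R]_d, countable [set t : R | A (consrV (x, t))]) -> leb A = 0.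
Proof.
move=> mA h; rewrite /leb lebesgueSE integral0_eq// => x _.
exact: countable_lebesgue_measure0.
Qed.

(** Induction on the dimension: a translation acts separately on the first coordinate and on the
    remaining ones. *)
Lemma leb_translation d (v : 'rV[R]_d) A : measurable A ->
  leb ((fun x => x + v)%R @^-1` A) = leb A.
Proof.
rewrite /leb; elim: d v A => [|d ih] v A mA.
  by rewrite (_ : _ @^-1` _ = A)//; apply/funext => x; rewrite /preimage/= (thinmx0 v) addr0.
have [w [c ->]] : exists w c, v = consrV (w, c).
  exists (\row_j v ord0 (lift ord0 j)), (v ord0 ord0); apply/rowP => i.
  by have [j ->|->] := unliftP ord0 i; rewrite ?consrV_lift ?mxE ?consrV0 ?unlift_none//=.
have cD x t : (consrV (x, t) + consrV (w, c) = consrV (x + w, t + c))%R.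
  apply/rowP => i; rewrite !mxE; case: unliftP => //= j _; by rewrite mxE.
rewrite !lebesgueSE.
pose f x := lebesgue_measure [set t : measurableTypeR R | A (consrV (x, t))].
transitivity (\int[lebesgue R d]_x f (x + w)%R).
  apply: eq_integral => x _; rewrite /f.
  rewrite -[RHS](lebesgue_measure_translation c (measurable_section_consrV _ mA)).
  by congr lebesgue_measure; apply/seteqP; split => t /=; rewrite cD.
have mw : measurable_fun setT (fun x : 'rV[R]_d => x + w)%R.
  exact: measurable_isometry (translation w).
rewrite -[RHS]/(\int[lebesgue R d]_x f x).
have mf : measurable_fun setT f by exact: measurable_fun_section_consrV.
pose m := measure_function_pushforward__canonical__measure_function_Measure
  (lebesgue R d) mw.
transitivity (\int[m]_x f x); first by apply/esym/ge0_integral_pushforward.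
by apply: eq_measure_integral => B mB _; exact: ih.
Qed.

(** * Invariance of Lebesgue measure under isometries *)

Section isometry.
Context (d : nat).
Implicit Types (T : isometry R d) (A : set 'rV[R]_d).

Lemma isometry_inverse T : exists T' : isometry R d, cancel T T' /\ cancel T' T.
Proof.
have [U UU TE] := isometry_affine T.
have UU' := mulmx1C UU.
pose f y := ((y - T 0) *m U^T)%R.
have Tf : cancel f T by move=> y; rewrite /f TE -mulmxA UU' mulmx1 subrK.
have fT : cancel T f by move=> y; apply: (@isometry_inj _ _ T); rewrite Tf.
have ff x y : edist (f x) (f y) = edist x y by rewrite -(edist_isometry T) !Tf.
by exists (Isometry ff).
Qed.

Lemma eball_isometry T z s : T @^-1` eball (T z) s = eball z s.
Proof. by apply/seteqP; split => x; rewrite /eball/= edist_isometry. Qed.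

(* With [mu] translation invariant, substituting [x + y] for [x] in the double
   integral of [A x] and [B (x - y)] turns [mu A * leb B] into
   [mu (- B) * leb A]. *)
Lemma translation_invariant_leb (mu : {sigma_finite_measure set 'rV[R]_d -> \bar R})
    (A B : set 'rV[R]_d) :
  (forall v C, measurable C ->
    mu ((fun x : 'rV[R]_d => x + v)%R @^-1` C) = mu C) ->
  measurable A -> measurable B ->
  (forall x, B x -> B (- x)%R) -> 
  mu A * leb B = leb A * mu B.
Proof.
move=> muT mA mB BN.
have m1 : measurable_fun setT (@fst 'rV[R]_d 'rV[R]_d) by exact: measurable_fst.
have m2 : measurable_fun setT (@snd 'rV[R]_d 'rV[R]_d) by exact: measurable_snd.
have maddr v : measurable_fun setT (fun x : 'rV[R]_d => x + v)%R.
  exact: (measurable_isometry (translation v)).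
have mrefl v : measurable_fun setT (fun x : 'rV[R]_d => v - x)%R.
  by apply: measurable_addrV; [exact: measurable_cst|exact/measurable_opprV/measurable_id].
rewrite -(@ge0_integral_indic_cst _ _ _ mu _ _
  (fun x => leb [set y | A x /\ B (y - x)%R]))//; last 2 first.
- move=> x Ax; rewrite -(@leb_translation _ (- x)%R B)//.
  by congr leb; apply/seteqP; split => y //= [].
- move=> x Ax; rewrite [X in leb X](_ : _ = set0) ?measure0//.
  by rewrite -subset0 => y [].
rewrite (@sfinite_fubini_set _ _ _ _ _ mu (@leb d)
  [set p | A p.1 /\ B (p.2 - p.1)%R]); last first.
  apply: measurableI; first exact: (measurable_preimageT m1 mA).
  exact: measurable_preimageT (measurable_addrV m2 (measurable_opprV m1)) mB.
transitivity (\int[@leb d]_y mu [set x | A (x + y)%R /\ B x]).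
  apply: eq_integral => y _; rewrite -[LHS](muT y); last first.
    by apply: measurableI => //; exact: (measurable_preimageT (mrefl y) mB).
  congr (mu _); apply/seteqP; split => x /=; rewrite opprD addrCA subrr addr0.
    by move=> [? /BN]; rewrite opprK.
  by move=> [? /BN].
rewrite -(@sfinite_fubini_set _ _ _ _ _ mu (@leb d)
  [set p | A (p.1 + p.2)%R /\ B p.1]); last first.
  apply: measurableI; last exact: (measurable_preimageT m1 mB).
  exact: measurable_preimageT (measurable_addrV m1 m2) mA.
rewrite muleC; apply: ge0_integral_indic_cst => // x Bx.
- rewrite -(@leb_translation _ x A)//.
  by congr leb; apply/seteqP; split => y /=; rewrite addrC => // -[].
- by rewrite (_ : [set y | _] = set0) ?measure0// -subset0 => y [].
Qed.

(** The image [mm] of Lebesgue measure under [T] is sigma-finite and translation invariant, hence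
    proportional to Lebesgue measure by [translation_invariant_leb]. The factor is 1, because the
    preimage of a ball around the origin is a translate of that ball. *)
Lemma leb_isometry T A : measurable A -> leb (T @^-1` A) = leb A.
Proof.
move=> mA; have [n /negP n0] := leb_eball_neq0 d.
set B := eball (0 : 'rV[R]_d) n%:R in n0.
have [T' [TT' T'T]] := isometry_inverse T.
pose m := measure_function_pushforward__canonical__measure_function_Measure
  (@leb d) (measurable_isometry T).
have msf : sigma_finite setT m.
  exists (fun n => eball (T 0%R) n%:R); first by rewrite eball_cover.
  move=> k; split; first exact: measurable_eball.
  by rewrite /= /pushforward eball_isometry; exact: eball_lty.
have [mm mmE'] := sigma_finite_bundle msf.
have mmE C : mm C = leb (T @^-1` C) by rewrite mmE'.
have [U UU TE] := isometry_affine T.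
(* Translation by [v] after [T] is translation by [v *m U^T] before it; this carries translation
   invariance to the image measure. *)
have T0 x v : (T x + v = T (x + v *m U^T))%R.
  by rewrite TE [in RHS]TE mulmxDl -mulmxA (mulmx1C UU) mulmx1 addrAC.
have mT C : measurable C -> measurable (T @^-1` C).
  exact: measurable_preimageT (measurable_isometry T).
have TB : leb (T @^-1` B) = leb B.
  rewrite -[RHS](leb_translation (- T' 0)%R); last exact: measurable_eball.
  congr leb; apply/seteqP; split => x /=; rewrite /B /eball/=.
    by rewrite -{1}(T'T 0%R) edist_isometry /edist subr0.
  by rewrite -{3}(T'T 0%R) edist_isometry /edist subr0.
have : mm A * leb B = leb A * mm B.
  apply: translation_invariant_leb => //; last 2 first.
  - exact: measurable_eball.
  - by move=> x; rewrite /B /eball/= !edist0 enormN.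
  move=> v C mC; rewrite !mmE -[RHS](leb_translation (v *m U^T)%R (mT _ mC)).
  by congr leb; apply/seteqP; split => x /=; rewrite T0.
rewrite !mmE TB => h.
have Bfin : leb B \is a fin_num by rewrite ge0_fin_numE//; exact: eball_lty.
have B0 : 0 < leb B by rewrite lt0e measure_ge0 andbT; apply/negP.
exact: mule_cancelr h.
Qed.

End isometry.

(** * Null spheres and bisectors *)

Section null_sets.

Lemma measurable_sphere d (z : 'rV[R]_d) s : measurable [set x | edist x z = s].
Proof.
have mz := measurable_edist (@measurable_id _ 'rV[R]_d setT) (measurable_cst z).
exact: (measurable_preimageT mz (measurable_set1 s)).
Qed.

(** In dimension 0 the sphere of radius 0 is the whole space and has measure 1, whence [1 <= d]. *)
Lemma leb_sphere d (z : 'rV[R]_d) s : (1 <= d)%N -> leb [set x | edist x z = s] = 0.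
Proof.
case: d z => // d z _.
apply: leb_null_sections => [|x]; first exact: measurable_sphere.
(* On a line parallel to the first axis, [a] is the fixed contribution of the other coordinates, so
   a point of the sphere satisfies [(t - z ord0 ord0)^2 = s^2 - a]. *)
pose a := (\sum_(i < d) (x ord0 i - z ord0 (lift ord0 i)) ^+ 2)%R.
pose q := Num.sqrt (s ^+ 2 - a)%R.
apply: (@sub_countable _ _ _ [set (z ord0 ord0 + q)%R; (z ord0 ord0 - q)%R]).
  apply: subset_card_le => t /= ts.
  have : ((t - z ord0 ord0) ^+ 2 + a = s ^+ 2)%R.
    rewrite -ts edist_sqr big_ord_recl consrV0; congr (_ + _)%R.
    by apply: eq_bigr => i _; rewrite consrV_lift.
  move=> /(congr1 (fun u => u - a)%R); rewrite addrK => /(congr1 Num.sqrt).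
  rewrite sqrtr_sqr -/q => tq.
  by case: ger0P tq => _ <-; [left|right]; ring.
exact/finite_set_countable.
Qed.

(** Lets [leb_bisector] assume that the two points differ in the first coordinate, the one that
    varies along the sections in [leb_null_sections]. *)
Lemma swap_isometry d (i j : 'I_d) : exists2 T : isometry R d, involutive T &
  forall x, T x ord0 i = x ord0 j.
Proof.
pose T (x : 'rV[R]_d) := (\row_k x ord0 (tperm i j k))%R.
have Tiso x y : edist (T x) (T y) = edist x y.
  congr Num.sqrt; rewrite [RHS](reindex_inj (@perm_inj _ (tperm i j))) /=.
  by apply: eq_bigr => k _; rewrite !mxE.
exists (Isometry Tiso) => [x|x]; last by rewrite mxE tpermL.
by apply/rowP => k; rewrite !mxE tpermK.
Qed.

Lemma measurable_bisector d (y z : 'rV[R]_d) : measurable [set x | edist x y = edist x z].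
Proof.
rewrite (_ : [set x | _] = (fun x => edist x y - edist x z)%R @^-1` [set 0%R]); last first.
  apply/seteqP; split => x /=; first by move=> ->; rewrite subrr.
  by move=> /eqP; rewrite subr_eq0 => /eqP.
apply: measurable_preimageT (measurable_set1 _).
have m w : measurable_fun setT (fun x : 'rV[R]_d => edist x w).
  exact: (measurable_edist (@measurable_id _ 'rV[R]_d setT) (measurable_cst w)).
exact: measurable_funB (m y) (m z).
Qed.

Lemma leb_bisector d (y z : 'rV[R]_d) : y <> z -> leb [set x | edist x y = edist x z] = 0.
Proof.
case: d y z => [|d] y z yz; first by case: yz; rewrite (thinmx0 y) (thinmx0 z).
have [i yzi] : exists i, y ord0 i <> z ord0 i.
  by apply: contra_notP yz => /forallNP h; apply/rowP => i; apply: contrapT.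
wlog : y z yz i yzi / i = ord0.
  move=> wlg; have [T TT Ti] := swap_isometry ord0 i.
  rewrite -(leb_isometry T); last exact: measurable_bisector.
  rewrite (_ : _ @^-1` _ = [set x | edist x (T y) = edist x (T z)]); last first.
    have TC x w : edist (T x) w = edist x (T w) by rewrite -(edist_isometry T) TT.
    by apply/seteqP; split => x /=; rewrite !TC.
  apply: (wlg _ _ _ ord0) => //; last by rewrite !Ti.
  by move=> /(@isometry_inj _ _ T).
move=> i0; subst i; apply: leb_null_sections => [|x]; first exact: measurable_bisector.
pose a (w : 'rV[R]_d.+1) := (\sum_(i < d) (x ord0 i - w ord0 (lift ord0 i)) ^+ 2)%R.
set y0 := y ord0 ord0 in yzi; set z0 := z ord0 ord0 in yzi.
have zy0 : (2 * (z0 - y0) != 0)%R.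
  by rewrite mulf_neq0 ?pnatr_eq0// subr_eq0; apply/eqP/nesym.
(* The squares of [t] cancel in the equality of squared distances, leaving a linear equation in [t]
   of slope [2 * (z0 - y0)]; this is its root. *)
apply: (@sub_countable _ _ _ [set ((z0 ^+ 2 - y0 ^+ 2 + a z - a y) / (2 * (z0 - y0)))%R]).
  apply: subset_card_le => t /= ts.
  have h w : (edist (consrV (x, t)) w ^+ 2 = (t - w ord0 ord0) ^+ 2 + a w)%R.
    rewrite edist_sqr big_ord_recl consrV0; congr (_ + _)%R.
    by apply: eq_bigr => i _; rewrite consrV_lift.
  have : ((t - y0) ^+ 2 + a y = (t - z0) ^+ 2 + a z)%R by rewrite -!h ts.
  by move=> tt; apply: (mulIf zy0); rewrite divfK//; move: tt; rewrite !expr2; lra.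
exact/finite_set_countable.
Qed.

End null_sets.

End lebesgue_theory.

(** * Countable families and monotone limits of sets *)

Section measure_facts.
Context d (T : measurableType d) (R : realType) (mu : {measure set T -> \bar R}).

(** Indexing through an injection into [nat], rather than an enumeration, allows [D] to be empty;
    each fibre then holds at most one index. *)
Lemma countable_inj (I : Type) (D : set I) : countable D ->
  exists g : I -> nat, forall i j, D i -> D j -> g i = g j -> i = j.
Proof.
move=> /countable_injP[g ginj]; exists g => i j Di Dj ij.
by apply: ginj; rewrite ?inE.
Qed.

Lemma countable_bigcup_measurable (I : Type) (D : set I) (F : I -> set T) :
  countable D -> (forall i, D i -> measurable (F i)) ->
  measurable (\bigcup_(i in D) F i).
Proof.
move=> /countable_inj[g ginj] mF.
rewrite (_ : \bigcup_(i in D) F i =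
    \bigcup_n \bigcup_(i in [set i | D i /\ g i = n]) F i); last first.
  apply/seteqP; split => [x [i Di Fx]|x [n _ [i [Di _] Fx]]]; last by exists i.
  by exists (g i) => //; exists i.
apply: bigcupT_measurable => n.
have [[i [Di gi]]|h] := pselect (exists i, D i /\ g i = n).
  rewrite (_ : \bigcup_(_ in _) _ = F i); first exact: mF.
  apply/seteqP; split => [x [j [Dj gj] Fx]|x Fx]; last by exists i.
  by rewrite (ginj i j)// gi gj.
rewrite (_ : \bigcup_(_ in _) _ = set0)// -subset0 => x [i Di _].
by apply: h; exists i.
Qed.

Lemma ae_countable (I : Type) (D : set I) (P : I -> T -> Prop) :
  countable D -> (forall i, D i -> {ae mu, forall x, P i x}) ->
  {ae mu, forall x, forall i, D i -> P i x}.
Proof.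
move=> /countable_inj[g ginj] h.
have /ae_foralln : forall n, {ae mu, forall x, forall i, D i -> g i = n -> P i x}.
  move=> n; have [[i [Di gi]]|h'] := pselect (exists i, D i /\ g i = n).
    apply: filterS (h i Di) => x Px j Dj gj.
    by rewrite (ginj j i)// gi gj.
  by apply: aeW => x i Di gi; exfalso; apply: h'; exists i.
by apply: filterS => x H i Di; exact: H.
Qed.

Lemma ae_le_measure (A B : set T) : measurable A -> measurable B ->
  {ae mu, forall x, A x -> B x} -> mu A <= mu B.
Proof.
move=> mA mB [N [mN N0 AB]].
apply: (@le_trans _ _ (mu (B `|` N))).
  rewrite le_measure ?inE//; first exact: measurableU.
  move=> x Ax; have [Bx|nBx] := pselect (B x); [by left|right].
  by apply: AB => /(_ Ax).
have N0' : mu N <= 0 by rewrite N0.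
by apply: (le_trans (measureU2 mu mB mN)); rewrite -[leRHS]adde0; exact: leeD.
Qed.

Lemma ae_eq_measure (A B : set T) : measurable A -> measurable B ->
  {ae mu, forall x, A x <-> B x} -> mu A = mu B.
Proof.
move=> mA mB AB; apply/le_anti/andP; split; apply: ae_le_measure => //;
  by apply: filterS AB => x [].
Qed.

Lemma null_set_ae (A : set T) : measurable A -> mu A = 0 -> {ae mu, forall x, ~ A x}.
Proof. by move=> mA A0; exists A; split => // x /= /contrapT. Qed.

Lemma measure_bigcup_le (F : (set T)^nat) (a : \bar R) :
  (forall n, measurable (F n)) -> (forall n, F n `<=` F n.+1) ->
  (forall n, mu (F n) <= a) -> mu (\bigcup_n F n) <= a.
Proof.
move=> mF ndF Fa.
have cv := @nondecreasing_cvg_mu _ _ _ mu F mF (bigcupT_measurable _ mF).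
have nd : {homo F : n m / (n <= m)%N >-> (n <= m)%O}.
  by apply: homo_leq => // [A B C|n]; [exact: le_trans|exact/subsetPset/ndF].
move/cvg_lim : (cv nd) => <- //; apply: lime_le.
  by apply/cvg_ex; exists (mu (\bigcup_n F n)); exact: cv.
by apply: nearW => n; exact: Fa.
Qed.

Lemma measure_bigcap_ge (F : (set T)^nat) (a : \bar R) :
  (forall n, measurable (F n)) -> (forall n, F n.+1 `<=` F n) ->
  mu (F 0%N) < +oo -> (forall n, a <= mu (F n)) -> a <= mu (\bigcap_n F n).
Proof.
move=> mF niF F0 Fa.
have cv := @nonincreasing_cvg_mu _ _ _ mu F F0 mF (bigcapT_measurable mF).
have ni : {homo F : n m / (n <= m)%N >-> (m <= n)%O}.
  by apply: (@homo_leq _ _ (fun A B => (B <= A)%O)) => // [A B C BA CA|n];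
    [exact: le_trans CA BA|exact/subsetPset/niF].
move/cvg_lim : (cv ni) => <- //; apply: lime_ge.
  by apply/cvg_ex; exists (mu (\bigcap_n F n)); exact: cv.
by apply: nearW => n; exact: Fa.
Qed.

End measure_facts.

Lemma finite_set_eventually (I : choiceType) (F : set I) (P : nat -> I -> Prop) :
  finite_set F -> (forall i, F i -> exists n, forall m, (n <= m)%N -> P m i) ->
  exists N, forall i, F i -> P N i.
Proof.
move=> /finite_seqP[s ->] h.
suff [N hN] : exists N, forall m, (N <= m)%N -> forall i, i \in s -> P m i.
  by exists N => i; exact: hN.
elim: s h => [|j s ih] h; first by exists 0%N.
have [|N hN] := ih; first by move=> i si; apply: h; rewrite /= inE si orbT.
have [|n hn] := h j; first by rewrite /= inE eqxx.
exists (maxn n N) => m; rewrite geq_max => /andP[nm Nm] i.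
by rewrite inE => /predU1P[->|]; [exact: hn|exact: hN].
Qed.

Lemma ereal_between (R : realType) (x y : \bar R) : 0 <= x -> x < y ->
  exists2 s : R, (0 <= s)%R & x < s%:E < y.
Proof.
case: x => [x| |] //; last by case: y.
rewrite lee_fin => x0; case: y => [y| |] // xy.
  exists ((x + y) / 2)%R; rewrite ?lte_fin; move: xy; rewrite lte_fin; lra.
by exists (x + 1)%R; [lra|rewrite lte_fin ltry andbT; lra].
Qed.

(** * Stable allocations of a fixed set of centers *)

Section radii.
Context (R : realType) (d : nat).
Implicit Types (Xi : set 'rV[R]_d) (r : 'rV[R]_d -> \bar R) (x z xi eta : 'rV[R]_d).

(* A function [r] prescribes to each center the radius within which it accepts
   sites. *)
Definition closer Xi r x (t : R) : Prop :=
  exists eta, [/\ Xi eta, (edist x eta < t)%R & (edist x eta)%:E < r eta].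

(** Since distances are compared strictly, [z] is never its own rival: this set depends on the radii
    of the other centers only. *)
Definition avail Xi r z (s : R) : set 'rV[R]_d :=
  [set x | (edist x z < s)%R /\ ~ closer Xi r x (edist x z)].

Definition near Xi r x xi : Prop :=
  [/\ Xi xi, (edist x xi)%:E < r xi & ~ closer Xi r x (edist x xi)].

Definition generic Xi x : Prop :=
  forall xi eta, Xi xi -> Xi eta -> edist x xi = edist x eta -> xi = eta.

(* Sites with several nearest accepting centers are sent to [Delta]. *)
Definition alloc Xi r x : assignment R d :=
  if pselect (exists xi, near Xi r x xi) is left e then
    if `[< forall eta, near Xi r x eta -> eta = sval (cid e) >]
    then Center (sval (cid e)) else Delta
  else Infty.

Definition radius_sup (alpha : R) Xi r z : \bar R :=
  ereal_sup [set s%:E | s in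
    [set s : R | (0 <= s)%R /\ leb (avail Xi r z s) <= alpha%:E]].

(** When no ball offers volume [alpha], this is the infimum of the empty set, [+oo]. *)
Definition radius_inf (alpha : R) Xi r z : \bar R :=
  ereal_inf [set s%:E | s in
    [set s : R | (0 <= s)%R /\ alpha%:E <= leb (avail Xi r z s)]].

Definition rsup_seq alpha Xi (n : nat) : 'rV[R]_d -> \bar R :=
  iter n (radius_sup alpha Xi) (fun=> +oo).

Definition rinf_seq alpha Xi (n : nat) : 'rV[R]_d -> \bar R :=
  iter n (radius_inf alpha Xi) (fun=> 0).

Definition rmax alpha Xi z : \bar R := ereal_inf (range (fun n => rsup_seq alpha Xi n z)).

Definition rmin alpha Xi z : \bar R := ereal_sup (range (fun n => rinf_seq alpha Xi n z)).

(** * Monotonicity and measurability of the available sets *)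

Lemma locally_finite_countable Xi : locally_finite Xi -> countable Xi.
Proof.
move=> lf; rewrite (_ : Xi = \bigcup_n (Xi `&` eball 0 n%:R)); last first.
  by rewrite -setI_bigcupr eball_cover setIT.
apply: bigcup_countable => // n _; apply: finite_set_countable; apply: lf.
by exists n%:R => x; rewrite /eball/= edist0; exact: ltW.
Qed.

Lemma locally_finite_eball Xi z s : locally_finite Xi -> finite_set (Xi `&` eball z s).
Proof.
move=> lf; apply: lf; exists (2 * (s + enorm z))%R => x /= xz.
rewrite -(subrK z x); apply: (le_trans (enormD_le _ _)).
by rewrite ler_pM2l// lerD2r; exact: ltW.
Qed.

Lemma closer_le Xi r r' x t t' : (forall z, Xi z -> r z <= r' z) -> (t <= t')%R ->
  closer Xi r x t -> closer Xi r' x t'.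
Proof.
move=> rr' tt' [eta [Xe xt xr]]; exists eta; split => //.
  exact: lt_le_trans tt'.
exact: lt_le_trans (rr' _ Xe).
Qed.

Lemma avail_le Xi r z s s' : (s <= s')%R -> avail Xi r z s `<=` avail Xi r z s'.
Proof. by move=> ss' x [xs nc]; split => //; exact: lt_le_trans ss'. Qed.

Lemma avail_anti Xi r r' z s : (forall z, Xi z -> r z <= r' z) ->
  avail Xi r' z s `<=` avail Xi r z s.
Proof. by move=> rr' x [xs nc]; split => // c; apply: nc; apply: closer_le c. Qed.

Lemma measurable_edist_lt (f : 'rV[R]_d -> R) z : measurable_fun setT f ->
  measurable [set x | (edist x z < f x)%R].
Proof.
move=> mf; apply: measurable_ltr_set => //.
exact: (measurable_edist (@measurable_id _ 'rV[R]_d setT) (measurable_cst z)).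
Qed.

Lemma measurable_edist_lte (a : \bar R) z : measurable [set x | (edist x z)%:E < a].
Proof.
case: a => [a| |].
- rewrite (_ : [set x | _] = eball z a); first exact: measurable_eball.
  by apply/seteqP; split => x; rewrite /eball/= lte_fin.
- by rewrite (_ : [set x | _] = setT)//; apply/seteqP; split => x //=; rewrite ltry.
- by rewrite (_ : [set x | _] = set0)// -subset0.
Qed.

Lemma measurable_closer Xi r z : countable Xi ->
  measurable [set x | closer Xi r x (edist x z)].
Proof.
move=> cXi; rewrite (_ : [set x | _] = \bigcup_(eta in Xi)
    ([set x | (edist x eta < edist x z)%R] `&` [set x | (edist x eta)%:E < r eta])).
  apply: countable_bigcup_measurable => // eta _; apply: measurableI.
    apply: measurable_edist_lt.
    exact: (measurable_edist (@measurable_id _ 'rV[R]_d setT) (measurable_cst z)).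
  exact: measurable_edist_lte.
apply/seteqP; split => [x [eta [Xe xt xr]]|x [eta Xe [xt xr]]]; first by exists eta.
by exists eta.
Qed.

Lemma measurable_avail Xi r z s : countable Xi -> measurable (avail Xi r z s).
Proof.
move=> cXi; apply: measurableI; first exact: measurable_eball.
by apply: measurableC; exact: measurable_closer.
Qed.

Lemma avail_lty Xi r z s : countable Xi -> leb (avail Xi r z s) < +oo.
Proof.
move=> cXi; apply: le_lt_trans (eball_lty z s).
by rewrite le_measure ?inE//; [exact: measurable_avail|exact: measurable_eball|move=> x []].
Qed.

Lemma measurable_near Xi r xi : countable Xi -> measurable [set x | near Xi r x xi].
Proof.
move=> cXi; have [Xxi|nXxi] := pselect (Xi xi); last first.
  by rewrite (_ : [set x | _] = set0)// -subset0 => x [].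
rewrite (_ : [set x | _] = [set x | (edist x xi)%:E < r xi] `&`
    ~` [set x | closer Xi r x (edist x xi)]).
  apply: measurableI; first exact: measurable_edist_lte.
  by apply: measurableC; exact: measurable_closer.
by apply/seteqP; split => [x [_ ? ?]|x [? ?]].
Qed.

Lemma measurable_set1V (x : 'rV[R]_d) : measurable [set x].
Proof.
rewrite (_ : [set x] = [set y | edist y x = 0%R]); first exact: measurable_sphere.
by apply/seteqP; split => y /=; [move=> ->; rewrite edistxx|exact: edist_eq0].
Qed.

Lemma measurable_Center (xi : 'rV[R]_d) : measurable [set Center xi].
Proof.
rewrite -[measurable _]/(measurable (Center @^-1` [set Center xi] : set 'rV[R]_d)).
rewrite (_ : _ @^-1` _ = [set xi]); first exact: measurable_set1V.
by apply/seteqP; split => y /= => [[]|->].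
Qed.

Lemma measurable_Delta : measurable [set Delta : assignment R d].
Proof.
rewrite -[measurable _]/(measurable (Center @^-1` [set Delta] : set 'rV[R]_d)).
by rewrite (_ : _ @^-1` _ = set0)// -subset0.
Qed.

(** * The operators on radii and their extremal iterates *)

Section fixed_centers.
Context (alpha : R) (Xi : set 'rV[R]_d) (d1 : (1 <= d)%N) (alpha0 : (0 < alpha)%R)
  (lf : locally_finite Xi).

Let cXi : countable Xi := locally_finite_countable lf.

(** Left continuity: as the ball is open, [avail Xi r z s] is the increasing union of the sets of
    smaller radius. *)
Lemma leb_avail_le r z s a : (forall s', (s' < s)%R -> leb (avail Xi r z s') <= a) ->
  leb (avail Xi r z s) <= a.
Proof.
move=> h; rewrite (_ : avail _ _ _ s = \bigcup_n avail Xi r z (s - n.+1%:R^-1)%R).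
  apply: measure_bigcup_le => [n|n|n].
  - exact: measurable_avail.
  - apply: avail_le; rewrite lerD2l lerN2 lef_pV2 ?posrE// ler_nat//.
  - by apply: h; rewrite ltrBlDr ltrDl invr_gt0.
apply/seteqP; split => [x [xs nc]|x [n _]]; last first.
  by apply: avail_le; rewrite lerBlDr lerDl invr_ge0.
have sx : (0 < s - edist x z)%R by rewrite subr_gt0.
(* With this [n], [1 / (n + 1)] is less than [s - edist x z]. *)
exists (Num.Def.truncn (s - edist x z)^-1) => //; split => //.
rewrite ltrBrDr -ltrBrDl invf_plt ?posrE// .
exact: truncnS_gt.
Qed.

(** Right continuity: the intersection over larger radii exceeds [avail Xi r z s] at most by points
    of the sphere of radius [s], which is null. *)
Lemma leb_avail_ge r z s (a : \bar R) :
  (forall s', (s < s')%R -> a <= leb (avail Xi r z s')) ->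
  a <= leb (avail Xi r z s).
Proof.
move=> h; apply: (@le_trans _ _ (leb (\bigcap_n avail Xi r z (s + n.+1%:R^-1)%R))).
  apply: measure_bigcap_ge => [n|n| |n].
  - exact: measurable_avail.
  - by apply: avail_le; rewrite lerD2l lef_pV2 ?posrE// ler_nat.
  - exact: avail_lty.
  - by apply: h; rewrite ltrDl invr_gt0.
apply: ae_le_measure; [|exact: measurable_avail|].
  by apply: bigcapT_measurable => n; exact: measurable_avail.
have := null_set_ae (measurable_sphere z s) (leb_sphere z s d1).
apply: filterS => x /= xs xn; split; last by case: (xn 0%N I).
rewrite lt_neqAle; apply/andP; split; first exact/eqP.
rewrite leNgt; apply/negP => sx.
have sx' : (0 < edist x z - s)%R by rewrite subr_gt0.
have [+ _] := xn (Num.Def.truncn (edist x z - s)^-1) I.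
apply/negP; rewrite -leNgt -lerBrDl invf_ple ?posrE//.
exact/ltW/truncnS_gt.
Qed.

Lemma avail0 r z s : (s <= 0)%R -> avail Xi r z s = set0.
Proof.
by move=> s0; rewrite -subset0 => x [/lt_le_trans/(_ s0)]; rewrite ltNge edist_ge0.
Qed.

Lemma radius_sup_ge0 r z : 0 <= radius_sup alpha Xi r z.
Proof.
apply: ereal_sup_ubound; exists 0%R => //; split => //.
by rewrite avail0// measure0 lee_fin ltW.
Qed.

Lemma radius_inf_ge0 r z : 0 <= radius_inf alpha Xi r z.
Proof. by apply: le_ereal_inf_tmp => _ [s [s0 _] <-]; rewrite lee_fin. Qed.

Lemma radius_sup_le r r' z : (forall z, Xi z -> r z <= r' z) ->
  radius_sup alpha Xi r z <= radius_sup alpha Xi r' z.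
Proof.
move=> rr'; apply: ereal_sup_le => _ [s [s0 sa] <-]; exists s => //; split => //.
apply: le_trans sa; rewrite le_measure ?inE//; [exact: measurable_avail..|].
exact: avail_anti.
Qed.

Lemma radius_inf_le r r' z : (forall z, Xi z -> r z <= r' z) ->
  radius_inf alpha Xi r z <= radius_inf alpha Xi r' z.
Proof.
move=> rr'; apply: ereal_inf_le_tmp => _ [s [s0 sa] <-]; exists s => //; split => //.
apply: (le_trans sa); rewrite le_measure ?inE//; [exact: measurable_avail..|].
exact: avail_anti.
Qed.

(** By left continuity the supremum itself still satisfies the constraint. *)
Lemma radius_sup_avail_le r z s : s%:E <= radius_sup alpha Xi r z ->
  leb (avail Xi r z s) <= alpha%:E.
Proof.
move=> sr; apply: leb_avail_le => s' s's.
have : s'%:E < radius_sup alpha Xi r z by apply: lt_le_trans sr; rewrite lte_fin.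
move=> /ereal_sup_gt[_ [t [t0 ta] <-]]; rewrite lte_fin => s't.
apply: le_trans ta; rewrite le_measure ?inE//; [exact: measurable_avail..|].
exact/avail_le/ltW.
Qed.

(** Every radius beyond a finite supremum offers more than [alpha], and right continuity brings the
    bound back. Together with [radius_sup_avail_le] the volume at a finite supremum is exactly
    [alpha]. *)
Lemma radius_sup_avail_ge r z s : radius_sup alpha Xi r z = s%:E ->
  alpha%:E <= leb (avail Xi r z s).
Proof.
move=> rs; apply: leb_avail_ge => t st; rewrite leNgt; apply/negP => ta.
have s0 : (0 <= s)%R by rewrite -lee_fin -rs radius_sup_ge0.
have : t%:E <= radius_sup alpha Xi r z.
  apply: ereal_sup_ubound; exists t => //; split; last exact: ltW.
  exact: le_trans (ltW st).
by rewrite rs lee_fin leNgt st.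
Qed.

Lemma radius_inf_avail_ge r z s : radius_inf alpha Xi r z <= s%:E ->
  alpha%:E <= leb (avail Xi r z s).
Proof.
move=> rs; apply: leb_avail_ge => t st.
have : radius_inf alpha Xi r z < t%:E by apply: le_lt_trans rs _; rewrite lte_fin.
move=> /ereal_inf_lt[_ [u [u0 ua] <-]]; rewrite lte_fin => ut.
apply: (le_trans ua); rewrite le_measure ?inE//; [exact: measurable_avail..|].
exact/avail_le/ltW.
Qed.

Lemma rsup_seqS_le n z : rsup_seq alpha Xi n.+1 z <= rsup_seq alpha Xi n z.
Proof.
elim: n z => [|n ih] z; first by rewrite /= leey.
by apply: radius_sup_le => w _; exact: ih.
Qed.

Lemma rinf_seqS_ge n z : rinf_seq alpha Xi n z <= rinf_seq alpha Xi n.+1 z.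
Proof.
elim: n z => [|n ih] z; first exact: radius_inf_ge0.
by apply: radius_inf_le => w _; exact: ih.
Qed.

Lemma rmax_le_seq n z : rmax alpha Xi z <= rsup_seq alpha Xi n z.
Proof. by apply: ereal_inf_lbound; exists n. Qed.

Lemma rinf_seq_le n z : rinf_seq alpha Xi n z <= rmin alpha Xi z.
Proof. by apply: ereal_sup_ubound; exists n. Qed.

Lemma rmax_ge0 z : 0 <= rmax alpha Xi z.
Proof.
apply: le_ereal_inf_tmp => _ [[|n] _ <-]; first by rewrite leey.
exact: radius_sup_ge0.
Qed.

Lemma rmin_ge0 z : 0 <= rmin alpha Xi z.
Proof. exact: rinf_seq_le 0%N z. Qed.

(** Off these spheres a distance that is at most a radius is strictly less than it, and conversely a
    rejected site lies strictly outside. *)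
Lemma ae_off_spheres (r : 'rV[R]_d -> \bar R) :
  {ae @leb R d, forall x, forall eta, Xi eta -> (edist x eta)%:E <> r eta}.
Proof.
apply: (ae_countable (P := fun eta x => (edist x eta)%:E <> r eta)) => // eta _.
case: (r eta) => [t| |]; last 2 first.
- by apply: aeW.
- by apply: aeW.
have := null_set_ae (measurable_sphere eta t) (leb_sphere eta t d1).
by apply: filterS => x /= xt [].
Qed.

Lemma rmax_ge_radius_sup z : radius_sup alpha Xi (rmax alpha Xi) z <= rmax alpha Xi z.
Proof.
apply: le_ereal_inf_tmp => _ [[|n] _ <-]; first by rewrite leey.
by apply: radius_sup_le => w _; exact: rmax_le_seq.
Qed.

(* The spheres of radius [rmax eta] are null, so off a null set every center
   that rejects a site in the limit already rejects it at a finite stage. *)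
Lemma leb_avail_rmax_le z s :
  (forall n, leb (avail Xi (rsup_seq alpha Xi n) z s) <= alpha%:E) ->
  leb (avail Xi (rmax alpha Xi) z s) <= alpha%:E.
Proof.
move=> h.
apply: (@le_trans _ _ (leb (\bigcup_n avail Xi (rsup_seq alpha Xi n) z s))); last first.
  apply: measure_bigcup_le => // n; first exact: measurable_avail.
  by apply: avail_anti => w _; exact: rsup_seqS_le.
apply: ae_le_measure; first exact: measurable_avail.
  by apply: bigcupT_measurable => n; exact: measurable_avail.
have := ae_off_spheres (rmax alpha Xi).
apply: filterS => x xne [xs nc].
(* Only the finitely many centers nearer to [x] than [z] can compete for it, so one stage at which
   all of them reject [x] can be chosen. *)
suff [N hN] : exists N, forall eta, (Xi `&` eball x (edist x z)) eta ->
    rsup_seq alpha Xi N eta <= (edist x eta)%:E.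
  exists N => //; split => // -[eta [Xe xe]]; rewrite ltNge hN//; split => //.
  by rewrite /eball/= edistC.
apply: finite_set_eventually; first exact: locally_finite_eball.
move=> eta [Xe]; rewrite /eball/= edistC => xe.
have : rmax alpha Xi eta < (edist x eta)%:E.
  rewrite lt_neqAle; apply/andP; split; first by apply/eqP => /esym; exact: xne.
  by rewrite leNgt; apply/negP => rx; apply: nc; exists eta.
move=> /ereal_inf_lt[_ [n _ <-]] /ltW nx; exists n => m nm; apply: le_trans nx.
elim: m nm => [|m ih]; first by rewrite leqn0 => /eqP ->.
rewrite leq_eqVlt => /predU1P[->//|nm].
exact: (le_trans (rsup_seqS_le _ _) (ih nm)).
Qed.

(** One inequality is monotonicity. If the other failed, take [s] strictly between the two sides:
    [s] is below every iterate, so each stage leaves at most [alpha] within distance [s], hence so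
    does the limit, and [s] is admissible in the supremum it was to exceed. *)
Lemma rmaxE z : radius_sup alpha Xi (rmax alpha Xi) z = rmax alpha Xi z.
Proof.
apply/le_anti; rewrite rmax_ge_radius_sup/= leNgt; apply/negP.
move=> /(ereal_between (radius_sup_ge0 _ _))[s s0 /andP[+ sr]].
rewrite ltNge => /negP; apply.
apply: ereal_sup_ubound; exists s => //; split => //; apply: leb_avail_rmax_le => n.
apply: radius_sup_avail_le; apply: (le_trans (ltW sr)).
exact: (rmax_le_seq n.+1).
Qed.

Lemma rmax_avail_le z s : s%:E <= rmax alpha Xi z ->
  leb (avail Xi (rmax alpha Xi) z s) <= alpha%:E.
Proof. by move=> h; apply: radius_sup_avail_le; rewrite rmaxE. Qed.

Lemma rmax_avail_ge z s : rmax alpha Xi z = s%:E ->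
  alpha%:E <= leb (avail Xi (rmax alpha Xi) z s).
Proof. by move=> h; apply: radius_sup_avail_ge; rewrite rmaxE. Qed.

(** A distance below the supremum is already below some iterate, so the available sets of the stages
    decrease to a subset of that of the limit. *)
Lemma rmin_avail_ge z s : rmin alpha Xi z = s%:E ->
  alpha%:E <= leb (avail Xi (rmin alpha Xi) z s).
Proof.
move=> rs.
apply: (@le_trans _ _ (leb (\bigcap_n avail Xi (rinf_seq alpha Xi n) z s))).
  apply: measure_bigcap_ge => [n|n| |n].
  - exact: measurable_avail.
  - by apply: avail_anti => w _; exact: rinf_seqS_ge.
  - exact: avail_lty.
  - by apply: radius_inf_avail_ge; rewrite -rs; exact: (rinf_seq_le n.+1).
rewrite le_measure ?inE//; last 2 first.
- exact: measurable_avail.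
- move=> x h; split; first by case: (h 0%N I).
  move=> [eta [Xe xe /ereal_sup_gt[_ [n _ <-]] xn]].
  by have [_] := h n I; apply; exists eta.
by apply: bigcapT_measurable => n; exact: measurable_avail.
Qed.

(** The hypothesis yields [r <= radius_sup r] on the centers, so by monotonicity [r] stays below
    every iterate started at [+oo]. *)
Lemma le_rmax r :
  (forall z s, Xi z -> (0 <= s)%R -> s%:E <= r z ->
    leb (avail Xi r z s) <= alpha%:E) ->
  forall z, Xi z -> r z <= rmax alpha Xi z.
Proof.
move=> h z Xz; apply: le_ereal_inf_tmp => _ [n _ <-]; elim: n z Xz => [|n ih] z Xz.
  by rewrite leey.
apply: (@le_trans _ _ (radius_sup alpha Xi r z)); last exact: radius_sup_le.
rewrite leNgt; apply/negP.
move=> /(ereal_between (radius_sup_ge0 _ _))[s s0 /andP[+ sr]].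
rewrite ltNge => /negP; apply; apply: ereal_sup_ubound; exists s => //.
by split => //; apply: h => //; exact: ltW.
Qed.

(** The hypothesis yields [radius_inf r <= r] on the centers, trivially where [r] is [+oo], so [r]
    stays above every iterate started at [0]. *)
Lemma ge_rmin r : (forall z, Xi z -> 0 <= r z) ->
  (forall z s, Xi z -> r z = s%:E -> alpha%:E <= leb (avail Xi r z s)) ->
  forall z, Xi z -> rmin alpha Xi z <= r z.
Proof.
move=> r0 h z Xz; apply: ge_ereal_sup => _ [n _ <-]; elim: n z Xz => [|n ih] z Xz.
  exact: r0.
apply: (@le_trans _ _ (radius_inf alpha Xi r z)); first exact: radius_inf_le.
have := r0 _ Xz; case rz : (r z) => [s| |] // => [s0|_]; last by rewrite leey.
by apply: ereal_inf_lbound; exists s => //; split => //; exact: h.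
Qed.

Lemma rmin_le_rmax z : Xi z -> rmin alpha Xi z <= rmax alpha Xi z.
Proof.
move=> Xz; apply: ge_rmin => // w; first by rewrite rmax_ge0.
by move=> s _; exact: rmax_avail_ge.
Qed.

Lemma near_avail r xi s : r xi <= s%:E ->
  [set x | near Xi r x xi] `<=` avail Xi r xi s.
Proof.
by move=> rs x [_ xr nc]; split => //; rewrite -lte_fin; exact: lt_le_trans rs.
Qed.

Lemma avail_near r xi s : Xi xi -> s%:E <= r xi ->
  avail Xi r xi s `<=` [set x | near Xi r x xi].
Proof.
by move=> Xxi sr x [xs nc]; split => //; apply: lt_le_trans sr; rewrite lte_fin.
Qed.

Lemma leb_near_le r xi a : 0 <= r xi ->
  (forall s, (0 <= s)%R -> s%:E <= r xi -> leb (avail Xi r xi s) <= a) ->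
  leb [set x | near Xi r x xi] <= a.
Proof.
case rxi : (r xi) => [s| |] // r0 h.
  apply: le_trans (h s _ _) => //; rewrite le_measure ?inE//.
  - exact: measurable_near.
  - exact: measurable_avail.
  - by apply: near_avail; rewrite rxi.
(* With an infinite radius, exhaust the territory by balls of integer radius. *)
apply: (@le_trans _ _ (leb (\bigcup_(n in [set: nat]) avail Xi r xi n%:R))); last first.
  apply: measure_bigcup_le => n; first exact: measurable_avail.
    by apply: avail_le; rewrite ler_nat.
  by apply: h; rewrite ?leey.
rewrite le_measure ?inE//; first exact: measurable_near.
  by apply: bigcupT_measurable => n; exact: measurable_avail.
move=> x [_ _ nc]; exists (Num.Def.archi_bound (edist x xi)) => //; split => //.
exact: archi_boundP (edist_ge0 _ _).
Qed.

Lemma leb_near_rmax_le xi : leb [set x | near Xi (rmax alpha Xi) x xi] <= alpha%:E.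
Proof.
by apply: leb_near_le => [|s _]; [exact: rmax_ge0|exact: rmax_avail_le].
Qed.

Lemma measurable_near_eball r xi t :
  measurable [set x | near Xi r x xi /\ (edist x xi < t)%R].
Proof. by apply: measurableI; [exact: measurable_near|exact: measurable_eball]. Qed.

(* Sites prefer [rmax] and centers prefer [rmin]; this is the half that mass
   transport turns against the other. *)
Lemma leb_near_rmax_rmin xi t : Xi xi ->
  leb [set x | near Xi (rmax alpha Xi) x xi /\ (edist x xi < t)%R] <=
  leb [set x | near Xi (rmin alpha Xi) x xi /\ (edist x xi < t)%R].
Proof.
move=> Xxi; have mN r := measurable_near_eball r xi t.
(* If [t] is at most [rmin], the center accepts the whole ball under both radii, and the larger
   rival radii of [rmax] leave it fewer sites. Otherwise the ball contains the whole [rmin]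
   territory, of volume at least [alpha], while the [rmax] territory never exceeds [alpha]. *)
have [tr|] := leP t%:E (rmin alpha Xi xi).
  rewrite le_measure ?inE// => x [[_ xr nc] xt]; split => //; split => //.
    by apply: lt_le_trans tr; rewrite lte_fin.
  by move=> c; apply: nc; apply: closer_le c => // w; exact: rmin_le_rmax.
case rs : (rmin alpha Xi xi) (rmin_ge0 xi) => [s| |] //; rewrite lee_fin lte_fin => s0 st.
apply: (@le_trans _ _ alpha%:E).
  apply: le_trans (leb_near_rmax_le xi); rewrite le_measure ?inE//.
    exact: measurable_near.
  by move=> x [].
apply: (le_trans (rmin_avail_ge rs)); rewrite le_measure ?inE//.
  exact: measurable_avail.
move=> x xa; split; last by case: xa => xs _; exact: lt_trans st.
by apply: avail_near xa => //; rewrite rs.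
Qed.

(** * The allocation defined by radii *)

Lemma near_le r x xi eta : near Xi r x xi -> Xi eta -> (edist x eta)%:E < r eta ->
  (edist x xi <= edist x eta)%R.
Proof.
by move=> [_ _ nc] Xe xr; rewrite leNgt; apply/negP => xe; apply: nc; exists eta.
Qed.

Lemma near_exists r x eta : Xi eta -> (edist x eta)%:E < r eta ->
  exists2 xi, near Xi r x xi & (edist x xi <= edist x eta)%R.
Proof.
move=> Xe xr.
(* The added 1 makes the open ball contain [eta] and every center no farther from [x], so the
   minimum over [s] is a minimum over all accepting centers. *)
have /finite_seqP[s sE] := locally_finite_eball x (edist x eta + 1)%R lf.
have argmin (l : seq 'rV[R]_d) : (exists2 i, i \in l & Xi i /\ (edist x i)%:E < r i) ->
    exists2 i, i \in l /\ Xi i /\ (edist x i)%:E < r i &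
      forall j, j \in l -> Xi j -> (edist x j)%:E < r j -> (edist x i <= edist x j)%R.
  elim: l => [[]//|j l ih [i il [Xi_ xri]]].
  have [[k kl [Xk rk]]|no] := pselect
      (exists2 i, i \in l & Xi i /\ (edist x i)%:E < r i); last first.
    exists j; last first.
      move=> k; rewrite inE => /predU1P[->//|kl] Xk rk.
      by exfalso; apply: no; exists k.
    move: il; rewrite inE => /predU1P[ij|il]; last by exfalso; apply: no; exists i.
    by rewrite -ij inE eqxx.
  have [|m [ml [Xm rm]] mmin] := ih; first by exists k.
  have [[Xj rj]|nj] := pselect (Xi j /\ (edist x j)%:E < r j); last first.
    exists m; first by rewrite inE ml orbT.
    by move=> n; rewrite inE => /predU1P[->|nl] Xn rn; [exfalso; apply: nj|exact: mmin].
  have [mj|jm] := leP (edist x m) (edist x j).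
    exists m; first by rewrite inE ml orbT.
    by move=> n; rewrite inE => /predU1P[->//|nl] Xn rn; exact: mmin.
  exists j; first by rewrite inE eqxx.
  move=> n; rewrite inE => /predU1P[->//|nl] Xn rn.
  exact: le_trans (ltW jm) (mmin n nl Xn rn).
have es : eta \in s.
  have : (Xi `&` eball x (edist x eta + 1)%R) eta.
    by split => //; rewrite /eball/= edistC ltrDl.
  by rewrite sE.
have [|xi [xis [Xxi xrxi]] xmin] := argmin s; first by exists eta.
exists xi; last exact: xmin.
split => // -[z [Xz xz zr]].
have : z \in s.
  have : (Xi `&` eball x (edist x eta + 1)%R) z.
    split => //; rewrite /eball/= edistC (lt_le_trans xz)//.
    by rewrite (le_trans (xmin _ es Xe xr))// lerDl.
  by rewrite sE.
by move=> /xmin/(_ Xz zr); rewrite leNgt xz.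
Qed.

Lemma generic_near r x xi eta : generic Xi x -> near Xi r x xi -> near Xi r x eta ->
  xi = eta.
Proof.
move=> gx nxi neta; apply: gx; [by case: nxi|by case: neta|].
by apply/le_anti/andP; split; apply: near_le; eauto; case: nxi neta => ? ? ? [? ? ?].
Qed.

Lemma ae_generic : {ae @leb R d, forall x, generic Xi x}.
Proof.
have : {ae @leb R d, forall x, forall xi, Xi xi -> forall eta, Xi eta ->
    edist x xi = edist x eta -> xi = eta}.
  apply: (ae_countable (P := fun xi x => forall eta, Xi eta ->
    edist x xi = edist x eta -> xi = eta)) => // xi _.
  apply: (ae_countable (P := fun eta x =>
    edist x xi = edist x eta -> xi = eta)) => // eta _.
  have [->|ne] := pselect (xi = eta); first exact: aeW.
  have := null_set_ae (measurable_bisector xi eta) (leb_bisector ne).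
  by apply: filterS => x /= h /h.
by apply: filterS => x h xi eta Xxi Xeta; exact: h.
Qed.

Lemma allocP r x :
  [\/ exists2 xi, alloc Xi r x = Center xi &
       near Xi r x xi /\ (forall eta, near Xi r x eta -> eta = xi),
     alloc Xi r x = Infty /\ (forall xi, ~ near Xi r x xi) |
     alloc Xi r x = Delta /\
       exists xi eta, [/\ near Xi r x xi, near Xi r x eta & xi <> eta]].
Proof.
rewrite /alloc; case: pselect => [e|ne]; last first.
  by constructor 2; split => // xi h; apply: ne; exists xi.
case: asboolP => [h|h].
  by constructor 1; exists (sval (cid e)) => //; split => //; exact: svalP.
constructor 3; split => //.
move/existsNP: h => [eta] /not_implyP[neta ne].
by exists eta, (sval (cid e)); split => //; exact: svalP.
Qed.

Lemma alloc_CenterP r x xi : alloc Xi r x = Center xi <->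
  near Xi r x xi /\ (forall eta, near Xi r x eta -> eta = xi).
Proof.
have [[eta -> [n1 n2]]|[-> no]|[-> [y [z [ny nz yz]]]]] := allocP r x.
- by split => [[<-]//|[nxi _]]; rewrite (n2 xi).
- by split => // -[/no].
- by split => // -[_ h]; exfalso; apply: yz; rewrite (h y)// (h z).
Qed.

Lemma alloc_InftyP r x : alloc Xi r x = Infty <-> forall xi, ~ near Xi r x xi.
Proof.
have [[eta -> [n1 n2]]|[-> no]|[-> [y [z [ny nz yz]]]]] := allocP r x => //.
- by split => // /(_ eta).
- by split => // /(_ y).
Qed.

Lemma alloc_generic r x : generic Xi x -> alloc Xi r x <> Delta.
Proof.
move=> gx; have [[eta ->]|[->]|[-> [y [z [ny nz yz]]]]] := allocP r x => // _.
by apply: yz; exact: generic_near gx ny nz.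
Qed.

(** If [x] desires [xi], then [xi] rejects [x], for otherwise [x] would be served at least as near.
    So the radius of [xi] is finite and at most the distance to [x]: its territory contains no
    farther site, and it has volume [alpha] by [rmax_avail_ge]. Hence [xi] does not covet [x]. *)
Lemma alloc_stable : measurable_fun setT (alloc Xi (rmax alpha Xi)) ->
  is_stable_allocation alpha Xi (alloc Xi (rmax alpha Xi)).
Proof.
move=> mpsi; set psi := alloc _ _ in mpsi *.
have mterr (A : set (assignment R d)) : measurable A -> measurable (psi @^-1` A).
  exact: measurable_preimageT.
have leb_terr xi : leb (territory psi xi) = leb [set x | near Xi (rmax alpha Xi) x xi].
  apply: ae_eq_measure.
  - by apply: mterr; exact: measurable_Center.
  - exact: measurable_near.
  apply: filterS ae_generic => x gx; split => [/alloc_CenterP[]//|nx].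
  by apply/alloc_CenterP; split => // eta neta; exact: generic_near neta nx.
split.
  split => //.
  - by move=> x xi /alloc_CenterP[[]].
  - have h := @ae_eq_measure _ _ _ (@leb R d) (psi @^-1` [set Delta]) set0.
    rewrite -[LHS]/(leb _) h ?measure0//; first by apply: mterr; exact: measurable_Delta.
    by apply: filterS ae_generic => x gx; split => // /(alloc_generic gx).
  - by move=> xi Xxi; rewrite -[leLHS]/(leb _) leb_terr leb_near_rmax_le.
move=> x xi [Xxi psixi psiD dx cx].
have xr : rmax alpha Xi xi <= (edist x xi)%:E.
  rewrite leNgt; apply/negP => xr.
  case: dx => [/alloc_InftyP no|[eta /alloc_CenterP[[_ _ nc] _] xe]].
    by have [z nz _] := near_exists Xxi xr; exact: (no z).
  by apply: nc; exists xi.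
case: cx => [usat|[x' /alloc_CenterP[[_ x'r _] _] xx']]; last first.
  by move: (lt_le_trans x'r xr); rewrite lte_fin ltNge (ltW xx').
apply: usat; rewrite /sated -[LHS]/(leb _) leb_terr; apply/le_anti; rewrite leb_near_rmax_le/=.
case rs : (rmax alpha Xi xi) xr (rmax_ge0 xi) => [s| |] // xr s0.
apply: (le_trans (rmax_avail_ge rs)); rewrite le_measure ?inE//.
- exact: measurable_avail.
- exact: measurable_near.
- by apply: avail_near => //; rewrite rs.
Qed.

(** * Radii of an arbitrary stable allocation *)

Section stable_radius.
Context (psi : 'rV[R]_d -> assignment R d) (st : is_stable_allocation alpha Xi psi).

(** Chosen so that [xi] covets every site at distance less than [r xi]; an unsated center covets
    everything, whence [+oo]. *)
Let r xi : \bar R := if `[< sated alpha psi xi >]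
  then ereal_sup [set (edist x xi)%:E | x in territory psi xi] else +oo.

Let r_covets x xi : (edist x xi)%:E < r xi -> covets alpha psi xi x.
Proof.
rewrite /r; case: asboolP => [_|us _]; last by left.
by move=> /ereal_sup_gt[_ [x' tx' <-]]; rewrite lte_fin => h; right; exists x'.
Qed.

Let r_territory x xi : psi x = Center xi -> (edist x xi)%:E <= r xi.
Proof.
move=> px; rewrite /r; case: asboolP => [_|]; last by rewrite leey.
by apply: ereal_sup_ubound; exists x.
Qed.

Let r_ge0 xi : 0 <= r xi.
Proof.
have [s|] := pselect (sated alpha psi xi); last by rewrite /r; case: asboolP.
have [[x px]|no] := pselect (exists x, psi x = Center xi).
  by apply: le_trans (r_territory px); rewrite lee_fin edist_ge0.
(* An empty territory would give the supremum [-oo]; a sated center has a nonempty one because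
   [0 < alpha]. *)
move: s; rewrite /sated (_ : territory psi xi = set0) ?measure0.
  by move=> [a0]; move: alpha0; rewrite -a0 ltxx.
by rewrite -subset0 => x px; apply: no; exists x.
Qed.

(** Both directions use stability. A strictly nearer accepting center would form an unstable pair
    with a claimed site, and so would a [near] center with an unclaimed one. Bisectors, the spheres
    of radius [r] and the sites sent to [Delta] are discarded. *)
Let stable_near : {ae @leb R d, forall x, generic Xi x /\ psi x <> Delta /\
  forall xi, psi x = Center xi <-> near Xi r x xi}.
Proof.
have [al ns] := st.
have aeD : {ae @leb R d, forall x, psi x <> Delta}.
  apply: (null_set_ae _ (allocation_Delta al)).
  exact: measurable_preimageT (allocation_measurable al) measurable_Delta.
apply: filterS3 aeD ae_generic (ae_off_spheres r) => x pD gx os.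
have cn xi : psi x = Center xi -> near Xi r x xi.
  move=> px; have Xxi := allocation_center al px; split => //.
    by rewrite lt_neqAle r_territory// andbT; apply/eqP/os.
  move=> [eta [Xe xe er]]; apply: (ns x eta); split => //.
  - by rewrite px => -[xie]; move: xe; rewrite xie ltxx.
  - by right; exists xi.
  - exact: r_covets.
split => //; split => // xi; split; first exact: cn.
move=> nx; case px : (psi x) => [eta| |] //.
  by congr Center; apply: generic_near (cn _ px) nx.
exfalso; apply: (ns x xi); case: nx => Xxi xr _; split => //.
- by rewrite px.
- by left.
- exact: r_covets.
Qed.

Let leb_stable_near xi : lebesgue R d (territory psi xi) = leb [set x | near Xi r x xi].
Proof.
have [al ns] := st; rewrite -[LHS]/(leb _); apply: ae_eq_measure.
- exact: measurable_preimageT (allocation_measurable al) (measurable_Center xi).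
- exact: measurable_near.
- by apply: filterS stable_near => x [_ [_ h]]; exact: (h xi).
Qed.

(** A center of finite radius is sated, so its [near] set has volume [alpha], as [ge_rmin] requires;
    every [near] set has volume at most [alpha], as [le_rmax] requires. *)
Lemma stable_radius : exists rho : 'rV[R]_d -> \bar R,
  [/\ forall xi, Xi xi -> rmin alpha Xi xi <= rho xi <= rmax alpha Xi xi &
      {ae @leb R d, forall x, generic Xi x /\ psi x <> Delta /\
        forall xi, psi x = Center xi <-> near Xi rho x xi}].
Proof.
have [al ns] := st.
exists r; split; last exact: stable_near.
move=> xi Xxi; apply/andP; split.
  apply: ge_rmin => // z s Xz rs; rewrite (_ : alpha%:E = leb [set x | near Xi r x z]).
    rewrite le_measure ?inE//.
    - exact: measurable_near.
    - exact: measurable_avail.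
    - by apply: near_avail; rewrite rs.
  by rewrite -leb_stable_near; move: rs; rewrite /r; case: asboolP.
apply: le_rmax => // z s Xz s0 sr.
apply: (@le_trans _ _ (leb [set x | near Xi r x z])).
  rewrite le_measure ?inE//.
  - exact: measurable_avail.
  - exact: measurable_near.
  - exact: avail_near.
by rewrite -leb_stable_near; exact: allocation_appetite al _ Xz.
Qed.

End stable_radius.

(** A squeeze. The center [z] serving [x] under [rmax] also accepts [x] under [rmin], hence under
    the radii of [psi], so [psi] serves [x] no farther than [z]. The center used by [psi] accepts
    [x] under [rmax], so it is no nearer than [z]. Off the bisectors the two coincide. *)
Lemma stable_ae_unique psi :
  {ae @leb R d, forall x, forall xi,
    near Xi (rmax alpha Xi) x xi -> near Xi (rmin alpha Xi) x xi} ->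
  is_stable_allocation alpha Xi psi ->
  {ae @leb R d, forall x, psi x = alloc Xi (rmax alpha Xi) x}.
Proof.
move=> aenear st; have [r [rr ae_r]] := stable_radius st.
apply: filterS2 aenear ae_r => x nn [gx [pD pr]].
have rmin_r z : Xi z -> (edist x z)%:E < rmin alpha Xi z -> (edist x z)%:E < r z.
  by move=> Xz /lt_le_trans; apply; case/andP: (rr _ Xz).
have r_rmax z : Xi z -> (edist x z)%:E < r z -> (edist x z)%:E < rmax alpha Xi z.
  by move=> Xz /lt_le_trans; apply; case/andP: (rr _ Xz).
apply/esym; case px : (psi x) => [xi| |] //; last first.
  apply/alloc_InftyP => xi /nn[Xxi xr _].
  by have [z /pr + _] := near_exists Xxi (rmin_r _ Xxi xr); rewrite px.
have nxi : near Xi r x xi by exact/pr.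
have [Xxi xr _] := nxi.
have [z nz zxi] := near_exists Xxi (r_rmax _ Xxi xr).
have [Xz zr _] := nn _ nz.
have xiz : xi = z.
  apply: (gx) => //; apply/le_anti; rewrite zxi andbT.
  exact: near_le nxi Xz (rmin_r _ Xz zr).
apply/alloc_CenterP; rewrite xiz; split => // eta neta.
exact: generic_near gx neta nz.
Qed.

End fixed_centers.

End radii.

Lemma measurable_lte_set disp (T : measurableType disp) (R : realType)
    (f g : T -> \bar R) : measurable_fun setT f -> measurable_fun setT g ->
  measurable [set t | f t < g t].
Proof.
by move=> mf mg; rewrite -[X in measurable X]setTI; exact: measurable_lte.
Qed.

Lemma measurable_fun_gt disp (T : measurableType disp) (R : realType) (f : T -> \bar R) :
  (forall c : R, measurable [set t | c%:E < f t]) -> measurable_fun setT f.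
Proof.
move=> h; apply: (measurability _ (ErealGenOInfty.measurableE R)).
move=> _ [_ [c ->] <-]; rewrite setTI; have := h c; congr measurable.
by apply/seteqP; split => t /=; rewrite in_itv/= andbT.
Qed.

Lemma measurable_fun_lt disp (T : measurableType disp) (R : realType) (f : T -> \bar R) :
  (forall c : R, measurable [set t | f t < c%:E]) -> measurable_fun setT f.
Proof.
move=> h; apply: (measurability _ (ErealGenInftyO.measurableE R)).
move=> _ [_ [c ->] <-]; by rewrite setTI; have := h c; congr measurable.
Qed.

(** * Equivariance and measurability in the point measure *)

Section isometry_image.
Context (R : realType) (d : nat) (T : isometry R d) (Xi : set 'rV[R]_d)
  (cXi : countable Xi).
Implicit Types r : 'rV[R]_d -> \bar R.

Let cTXi : countable (T @` Xi).
Proof. exact: sub_countable (card_image_le _ _) cXi. Qed.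

Lemma closer_image r r' x t : (forall z, r' (T z) = r z) ->
  closer (T @` Xi) r' (T x) t <-> closer Xi r x t.
Proof.
move=> rr; split => [[_ [[eta Xe <-] xt xr]]|[eta [Xe xt xr]]].
  by exists eta; rewrite edist_isometry rr in xt xr *.
by exists (T eta); rewrite edist_isometry rr; split => //; exists eta.
Qed.

Lemma near_image r r' x xi : (forall z, r' (T z) = r z) ->
  near (T @` Xi) r' (T x) (T xi) <-> near Xi r x xi.
Proof.
move=> rr; rewrite /near edist_isometry rr; split => -[Xxi xr nc]; split => //.
- by case: Xxi => eta Xe /(@isometry_inj _ _ T) <-.
- by move=> c; apply: nc; exact/(closer_image _ _ rr).
by move/(closer_image _ _ rr).
Qed.

Lemma leb_avail_image r r' z s : (forall z, r' (T z) = r z) ->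
  leb (avail (T @` Xi) r' (T z) s) = leb (avail Xi r z s).
Proof.
move=> rr; rewrite -(leb_isometry T); last exact: measurable_avail.
congr leb; apply/seteqP; split => x; rewrite /avail/= edist_isometry => -[xs nc];
  by split => // /(closer_image _ _ rr).
Qed.

Lemma radius_sup_image alpha r r' z : (forall z, r' (T z) = r z) ->
  radius_sup alpha (T @` Xi) r' (T z) = radius_sup alpha Xi r z.
Proof.
move=> rr; rewrite /radius_sup; under eq_fun do rewrite (leb_avail_image _ _ rr).
by [].
Qed.

Lemma rmax_image alpha z : rmax alpha (T @` Xi) (T z) = rmax alpha Xi z.
Proof.
have h n w : rsup_seq alpha (T @` Xi) n (T w) = rsup_seq alpha Xi n w.
  by elim: n w => [//|n ih] w; exact: (radius_sup_image alpha w ih).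
by congr ereal_inf; apply/seteqP; split => _ [n _ <-]; exists n; rewrite ?h.
Qed.

Lemma radius_inf_image alpha r r' z : (forall z, r' (T z) = r z) ->
  radius_inf alpha (T @` Xi) r' (T z) = radius_inf alpha Xi r z.
Proof.
move=> rr; rewrite /radius_inf; under eq_fun do rewrite (leb_avail_image _ _ rr).
by [].
Qed.

Lemma rmin_image alpha z : rmin alpha (T @` Xi) (T z) = rmin alpha Xi z.
Proof.
have h n w : rinf_seq alpha (T @` Xi) n (T w) = rinf_seq alpha Xi n w.
  by elim: n w => [//|n ih] w; exact: (radius_inf_image alpha w ih).
by congr ereal_sup; apply/seteqP; split => _ [n _ <-]; exists n; rewrite ?h.
Qed.

Lemma alloc_image r r' x : (forall z, r' (T z) = r z) ->
  alloc (T @` Xi) r' (T x) = assignment_map T (alloc Xi r x).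
Proof.
move=> rr.
have imT y : near (T @` Xi) r' (T x) y -> exists2 z, y = T z & near Xi r x z.
  move=> ny; have [[z Xz zy] _ _] := ny; exists z => //.
  by apply/(near_image _ _ rr); rewrite zy.
have [[xi -> [nxi u]]|[-> no]|[-> [y [z [ny nz yz]]]]] := allocP Xi r x.
- apply/alloc_CenterP; split; first exact/(near_image _ _ rr).
  by move=> _ /imT[z -> /u ->].
- by apply/alloc_InftyP => _ /imT[z _ /no].
- have [[xi _ [_ u]]|[_ no]|[-> //]] := allocP (T @` Xi) r' (T x).
    exfalso; apply: yz; apply: (@isometry_inj _ _ T).
    have uT w : near Xi r x w -> T w = xi by move=> nw; apply: u; exact/(near_image _ _ rr).
    by rewrite (uT _ ny) (uT _ nz).
  by exfalso; apply: (no (T y)); exact/(near_image _ _ rr).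
Qed.

End isometry_image.

(** * Point measures and local finiteness *)

Section point_measures.
Context (R : realType) (d : nat).
Local Notation spm := (simple_point_measure R d).
Implicit Types (pi : spm) (A B : set 'rV[R]_d).

Lemma spm_supportE pi : exists2 S : set 'rV[R]_d, countable S &
  spm_support pi = S /\ forall A, pi A = \esum_(z in S) \d_z A.
Proof.
have [S cS piE] := spm_simple pi; exists S => //; split => //.
have one z : S z -> pi [set z] = 1.
  move=> Sz; rewrite piE (esumID [set z]) // setIC.
  rewrite (_ : [set z] `&` S = [set z]); last by apply/setIidPl => _ ->.
  rewrite esum_set1// diracE mem_set// [X in _ + X]esum1 ?adde0// => w [_ /= wz].
  by rewrite diracE memNset// => wz'; apply: wz; rewrite wz'.
apply/seteqP; split => [z|z]; last exact: one.
rewrite /spm_support/= piE => z1; apply: contrapT => nSz.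
move: z1; rewrite esum1 => [/eqP|w Sw]; first by rewrite eqe eq_sym oner_eq0.
by rewrite diracE memNset// => wz; apply: nSz; rewrite -wz.
Qed.

Lemma spmE pi A : pi A = \esum_(z in spm_support pi `&` A) 1.
Proof.
have [S cS [-> ->]] := spm_supportE pi.
rewrite [LHS]esum_mkcond [RHS]esum_mkcond; apply: eq_esum => z _.
rewrite in_setI diracE; case: (z \in S) => //=; by case: (z \in A).
Qed.

(** Turns a quantifier over the centers into a condition on a mass, which can be measurable in
    [pi]. *)
Lemma spm_neq0 pi A : pi A != 0 <-> exists2 z, spm_support pi z & A z.
Proof.
split => [|[z Sz Az]].
  apply: contra_neqP => h; rewrite spmE (_ : _ `&` _ = set0) ?esum_set0//.
  by rewrite -subset0 => z [Sz Az]; apply: h; exists z.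
rewrite gt_eqF// (@lt_le_trans _ _ (pi [set z]))//; first by rewrite Sz.
rewrite Sz spmE; apply: esum_ge; exists [set z]; last by rewrite fsbig_set1.
by split => [|_ ->]; [exact: finite_set1|].
Qed.

Lemma spm_finite pi A : pi A < +oo -> finite_set (spm_support pi `&` A).
Proof.
move=> piA; apply: contrapT => inf.
have : pi A \is a fin_num by rewrite ge0_fin_numE.
move=> /fineK piAE; set n := (Num.Def.archi_bound (fine (pi A))).
have [B BSA nB] := infinite_set_fset n inf.
have : n%:R%:E <= pi A.
  rewrite spmE; apply: esum_ge; exists [set` B] => //.
  rewrite fsbig_finite//= set_fsetK (eq_bigr (fun=> 1%R%:E))// sumEFin lee_fin.
  by rewrite big_const_seq count_predT iter_addr_0 ler_nat.
rewrite -piAE lee_fin leNgt => /negP; apply; apply: archi_boundP.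
by apply: fine_ge0; exact: measure_ge0.
Qed.

Lemma spm_unique pi A z : spm_support pi z -> A z ->
  (forall w, spm_support pi w -> A w -> w = z) -> pi A = 1.
Proof.
move=> Sz Az u; rewrite spmE (_ : _ `&` _ = [set z]) ?esum_set1//.
by apply/seteqP; split => [w []|w ->]; [exact: u|split].
Qed.

Lemma measurable_spm_eval B : measurable B ->
  measurable_fun [set: spm] (fun pi : spm => pi B).
Proof.
move=> mB _ Y mY; rewrite setTI; apply: sub_sigma_algebra; exists B => //.
by exists Y => //; rewrite setTI.
Qed.

Lemma measurable_spm disp (T : measurableType disp) (f : T -> spm) :
  (forall B, measurable B -> measurable_fun setT (fun t => f t B)) ->
  measurable_fun setT f.
Proof.
move=> mf; apply: (@measurability _ _ _ _ _ _
  (\bigcup_(B in [set B : set 'rV[R]_d | measurable B])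
     preimage_set_system [set: spm] (fun pi : spm => pi B) measurable)) => //.
move=> _ [_ [B mB [Y mY <-]] <-]; rewrite setTI.
exact: mf.
Qed.

Lemma measurable_spm_image (T : isometry R d) : measurable_fun setT (spm_image T).
Proof.
apply: measurable_spm => B mB; apply: measurable_spm_eval.
exact: measurable_preimageT (measurable_isometry T) mB.
Qed.

Lemma spm_support_image (T : isometry R d) pi :
  spm_support (spm_image T pi) = T @` spm_support pi.
Proof.
have h z : T @^-1` [set T z] = [set z].
  by apply/seteqP; split => x /= => [/(@isometry_inj _ _ T)|->].
have [T' [TT' T'T]] := isometry_inverse T.
apply/seteqP; split => [z|_ [z Sz <-]]; rewrite /spm_support/= spm_imageE.
  by rewrite -(T'T z) h => ?; exists (T' z).
by rewrite h.
Qed.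

(** Local finiteness, put as countably many conditions on masses so that it is measurable. *)
Definition tame_spm : set spm := [set pi : spm | forall n : nat, pi (eball 0 n%:R) < +oo].

Lemma measurable_tame_spm : measurable tame_spm.
Proof.
rewrite (_ : tame_spm = \bigcap_n (fun pi : spm => pi (eball 0 n%:R)) @^-1` [set~ +oo]).
  apply: bigcapT_measurable => n; apply: measurable_preimageT; last exact: measurableC.
  exact: (measurable_spm_eval (measurable_eball 0%R n%:R)).
apply/seteqP; split => [pi h n _ /=|pi h n]; first by apply/eqP; rewrite lt_eqF.
by have := h n I; rewrite /= ltey => /eqP.
Qed.

Lemma tame_spm_eball pi z s : tame_spm pi -> pi (eball z s) < +oo.
Proof.
move=> tp; set n := Num.Def.archi_bound (2 * (s + enorm z)).
apply: le_lt_trans (tp n); rewrite le_measure ?inE//; [exact: measurable_eball..|].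
move=> x; rewrite /eball/= edist0 => xz.
apply: (@le_lt_trans _ _ (2 * (s + enorm z))%R).
  rewrite -(subrK z x); apply: (le_trans (enormD_le _ _)).
  by rewrite ler_pM2l// lerD2r; exact: ltW.
apply: archi_boundP; rewrite mulr_ge0// addr_ge0 ?sqrtr_ge0//.
exact: le_trans (edist_ge0 x z) (ltW xz).
Qed.

Lemma tame_spm_image (T : isometry R d) pi : tame_spm (spm_image T pi) <-> tame_spm pi.
Proof.
have h (U : isometry R d) rho : tame_spm rho -> tame_spm (spm_image U rho).
  have [U' [UU' U'U]] := isometry_inverse U.
  move=> tr n; rewrite spm_imageE -(U'U 0%R) eball_isometry.
  exact: tame_spm_eball.
split => [tp n|]; last exact: h.
have [T' [TT' T'T]] := isometry_inverse T.
rewrite (_ : eball _ _ = T @^-1` (T' @^-1` eball 0 n%:R)).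
  by have := h T' _ tp n; rewrite !spm_imageE.
by apply/seteqP; split => x /=; rewrite TT'.
Qed.

Lemma tame_spm_locally_finite pi : tame_spm pi -> locally_finite (spm_support pi).
Proof.
move=> tp B [r Br].
apply: (@sub_finite_set _ _ (spm_support pi `&` eball 0 (r + 1)%R)).
  move=> x [Sx Bx]; split => //; rewrite /eball/= edist0.
  by apply: le_lt_trans (Br _ Bx) _; rewrite ltrDl.
exact/spm_finite/tame_spm_eball.
Qed.

(* Off the full-measure set [tame_spm], the point measure is replaced by zero,
   so that measurability can be stated on the whole space. *)
Definition tame pi : spm := if pi \in tame_spm then pi else point.

Definition centers pi : set 'rV[R]_d := spm_support (tame pi).

Lemma point_spmE A : (point : spm) A = 0. Proof. by []. Qed.

Lemma tame_tame pi : tame_spm (tame pi).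
Proof. by rewrite /tame; case: ifPn => [/set_mem//|_ n]; rewrite point_spmE. Qed.

Lemma centers_locally_finite pi : locally_finite (centers pi).
Proof. exact/tame_spm_locally_finite/tame_tame. Qed.

Lemma centersE pi : tame_spm pi -> centers pi = spm_support pi.
Proof. by move=> tp; rewrite /centers /tame mem_set. Qed.

Lemma measurable_tame : measurable_fun setT tame.
Proof.
apply: measurable_spm => B mB.
rewrite (_ : (fun pi => _) = (fun pi => if pi \in tame_spm then pi B else 0)); last first.
  by apply/funext => pi; rewrite /tame; case: ifP.
apply: measurable_fun_ifT => //; last exact: measurable_spm_eval.
apply: (@measurable_fun_bool _ _ _ _ true).
rewrite setTI (_ : _ @^-1` _ = tame_spm); first exact: measurable_tame_spm.
by apply/seteqP; split => [pi /set_mem|pi /mem_set].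
Qed.

Lemma centers_image (T : isometry R d) pi : centers (spm_image T pi) = T @` centers pi.
Proof.
rewrite /centers /tame.
have [tp|ntp] := pselect (tame_spm pi).
  by rewrite !mem_set ?spm_support_image//; exact/tame_spm_image.
rewrite !memNset//; last by move/tame_spm_image.
have -> : spm_support (point : spm) = set0.
  by rewrite -subset0 => z /eqP; rewrite point_spmE eqe eq_sym oner_eq0.
by rewrite image_set0.
Qed.

(** * Measurability of sections and of quantifiers over centers *)

Section kernel.
Context disp (T : measurableType disp) (q : T -> spm) (mq : measurable_fun setT q).

Section trunc.
Context (n m : nat).

(** The masses [q t] gives to balls are finite but not bounded uniformly in [t]. Restricting to a
    ball, and discarding those [t] where it carries more than [m], gives a finite kernel, whose
    sections have measurable mass. *)
Definition trunc_kernel (t : T) : {measure set 'rV[R]_d -> \bar R} :=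
  if q t (eball 0 n%:R) <= m%:R%:E
  then (mrestr (q t) (measurable_eball 0%R n%:R) : {measure set 'rV[R]_d -> \bar R})
  else (mzero : {measure set 'rV[R]_d -> \bar R}).

Let measurable_trunc_kernel U : measurable U ->
  measurable_fun setT (trunc_kernel ^~ U).
Proof.
move=> mU; rewrite (_ : trunc_kernel ^~ U =
    (fun t => if q t (eball 0 n%:R) <= m%:R%:E then q t (U `&` eball 0 n%:R) else 0)); last first.
  by apply/funext => t; rewrite /trunc_kernel; case: ifP.
have me B : measurable B -> measurable_fun setT (fun t => q t B).
  by move=> mB; exact: (measurableT_comp (measurable_spm_eval mB) mq).
apply: measurable_fun_ifT => //.
  apply: measurable_fun_lee; last exact: measurable_cst.
  exact: (me _ (measurable_eball _ _)).
by apply: me; apply: measurableI => //; exact: measurable_eball.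
Qed.

HB.instance Definition _ := isKernel.Build _ _ _ _ _ trunc_kernel measurable_trunc_kernel.

Let trunc_kernel_uub : measure_fam_uub trunc_kernel.
Proof.
exists (m%:R + 1)%R => t; rewrite /trunc_kernel; case: ifP => [h|_].
  rewrite /= /mrestr setTI; apply: le_lt_trans h _; rewrite lte_fin ltrDl//.
by rewrite /= /mzero lte_fin.
Qed.

HB.instance Definition _ := Kernel_isFinite.Build _ _ _ _ _ trunc_kernel trunc_kernel_uub.

End trunc.

Hypothesis tq : forall t, tame_spm (q t).

(** A mass exceeds [c] exactly when that of one of the countably many truncations does: take the
    ball large enough, then [m] above its mass. *)
Lemma measurable_spm_section (E : set (T * 'rV[R]_d)) : measurable E ->
  measurable_fun setT (fun t => q t [set y | E (t, y)]).
Proof.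
move=> mE; apply: measurable_fun_gt => c.
have xE t : xsection E t = [set y | E (t, y)].
  by apply/seteqP; split => y; rewrite /xsection/= inE.
have mEt t : measurable [set y | E (t, y)] by rewrite -xE; exact: measurable_xsection.
have kE n m t : trunc_kernel n m t [set y | E (t, y)] =
    if q t (eball 0 n%:R) <= m%:R%:E then q t ([set y | E (t, y)] `&` eball 0 n%:R) else 0.
  by rewrite /trunc_kernel; case: ifP.
rewrite (_ : [set t | _] = \bigcup_n \bigcup_m
    [set t | c%:E < trunc_kernel n m t [set y | E (t, y)]]).
  apply: bigcupT_measurable => n; apply: bigcupT_measurable => m.
  have := @measurable_fun_xsection_finite_kernel _ _ _ _ _ (trunc_kernel n m) E.
  rewrite inE => /(_ mE) mf.
  have := measurable_lte_set (measurable_cst c%:E) mf.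
  by congr measurable; apply/seteqP; split => t /=; rewrite xE.
apply/seteqP; split => [t /= cq|t [n _ [m _]] /= ct]; last first.
  apply: (lt_le_trans ct); rewrite kE; case: ifP => _; last exact: measure_ge0.
  rewrite le_measure ?inE//; apply: measurableI => //; exact: measurable_eball.
have [n cn] : exists n, c%:E < q t ([set y | E (t, y)] `&` eball 0 n%:R).
  apply: contrapT => /forallNP h; move: cq; rewrite ltNge => /negP; apply.
  rewrite -[X in q t X]setIT -(eball_cover 0) setI_bigcupr.
  apply: measure_bigcup_le => n.
  - by apply: measurableI => //; exact: measurable_eball.
  - by apply: setIS => x; rewrite /eball/= => /lt_le_trans; apply; rewrite ler_nat.
  - by rewrite leNgt; exact/negP/h.
exists n => //.
have fn : q t (eball 0 n%:R) \is a fin_num by rewrite ge0_fin_numE//; exact: tq.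
exists (Num.Def.archi_bound (fine (q t (eball 0 n%:R)))) => //.
by rewrite /= kE ifT// -(fineK fn) lee_fin ltW// archi_boundP// fine_ge0.
Qed.

End kernel.

(** A projection of a measurable set need not be measurable; along the centers it is the event that
    the section of [E] has nonzero mass. *)
Lemma measurable_exists_center disp (T : measurableType disp) (p : T -> spm)
    (E : set (T * 'rV[R]_d)) : measurable_fun setT p -> measurable E ->
  measurable [set t | exists2 xi, centers (p t) xi & E (t, xi)].
Proof.
move=> mp mE; have mq := measurableT_comp measurable_tame mp.
have mf := @measurable_spm_section _ _ (tame \o p) mq (fun t => tame_tame (p t)) E mE.
have := measurable_preimageT mf (measurableC (emeasurable_set1 0)).
congr measurable; apply/seteqP; split => t /=; first by move/eqP/spm_neq0.
by move=> h; apply/eqP/spm_neq0.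
Qed.

(** * Joint measurability of the radii and of the allocation *)

Section joint_measurability.
Context (r : spm -> 'rV[R]_d -> \bar R)
  (mr : measurable_fun setT (fun p : spm * 'rV[R]_d => r p.1 p.2)).
Context disp (T : measurableType disp) (p : T -> spm) (x : T -> 'rV[R]_d)
  (mp : measurable_fun setT p) (mx : measurable_fun setT x).

Let m1 : measurable_fun setT (fun u : T * 'rV[R]_d => p u.1).
Proof. exact: measurableT_comp mp measurable_fst. Qed.

Let mx1 : measurable_fun setT (fun u : T * 'rV[R]_d => x u.1).
Proof. exact: measurableT_comp mx measurable_fst. Qed.

Lemma measurable_radius_comp : measurable_fun setT (fun t => r (p t) (x t)).
Proof. exact: (measurableT_comp mr (measurable_fun_pair mp mx)). Qed.

Lemma measurable_closer_joint (s : T -> R) : measurable_fun setT s ->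
  measurable [set t | closer (centers (p t)) (r (p t)) (x t) (s t)].
Proof.
move=> ms.
have me : measurable_fun setT (fun u : T * 'rV[R]_d => edist (x u.1) u.2).
  exact: measurable_edist mx1 measurable_snd.
have := @measurable_exists_center _ _ p [set u | (edist (x u.1) u.2 < s u.1)%R /\
  (edist (x u.1) u.2)%:E < r (p u.1) u.2] mp.
rewrite (_ : [set t | exists2 xi, _ & _] =
    [set t | closer (centers (p t)) (r (p t)) (x t) (s t)]); last first.
  by apply/seteqP; split => t /= [eta]; [move=> Xe [? ?]|move=> []]; exists eta.
apply; apply: measurableI.
  by apply: measurable_ltr_set => //; exact: measurableT_comp ms measurable_fst.
apply: measurable_lte_set; first exact/measurable_EFinP.
exact: (measurableT_comp mr (measurable_fun_pair m1 measurable_snd)).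
Qed.

Lemma measurable_centers_joint : measurable [set t | centers (p t) (x t)].
Proof.
have := @measurable_exists_center _ _ p [set u | edist (x u.1) u.2 = 0%R] mp.
rewrite (_ : [set t | exists2 xi, _ & _] = [set t | centers (p t) (x t)]); last first.
  apply/seteqP; split => t /= [].
    by move=> xi cxi /edist_eq0 ->.
  by move=> cx; exists (x t) => //; rewrite edistxx.
apply; apply: (measurable_preimageT _ (measurable_set1 0%R)).
exact: measurable_edist mx1 measurable_snd.
Qed.

End joint_measurability.

Lemma measurable_near_joint (r : spm -> 'rV[R]_d -> \bar R) disp
    (T : measurableType disp) (p : T -> spm) (x xi : T -> 'rV[R]_d) :
  measurable_fun setT (fun p : spm * 'rV[R]_d => r p.1 p.2) ->
  measurable_fun setT p -> measurable_fun setT x -> measurable_fun setT xi ->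
  measurable [set t | near (centers (p t)) (r (p t)) (x t) (xi t)].
Proof.
move=> mr mp mx mxi; have me := measurable_edist mx mxi.
rewrite (_ : [set t | _] = [set t | centers (p t) (xi t)] `&`
    ([set t | (edist (x t) (xi t))%:E < r (p t) (xi t)] `&`
    ~` [set t | closer (centers (p t)) (r (p t)) (x t) (edist (x t) (xi t))])); last first.
  by apply/seteqP; split => t; [move=> []|move=> [? []]].
apply: measurableI; first exact: measurable_centers_joint.
apply: measurableI; last by apply: measurableC; exact: measurable_closer_joint.
by apply: measurable_lte_set; [exact/measurable_EFinP|exact: measurable_radius_comp].
Qed.

Section radii_measurability.
Context (alpha : R).

Let leb_avail_measurable (r : spm -> 'rV[R]_d -> \bar R) s :
  measurable_fun setT (fun p : spm * 'rV[R]_d => r p.1 p.2) ->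
  measurable_fun setT (fun p : spm * 'rV[R]_d => leb (avail (centers p.1) (r p.1) p.2 s)).
Proof.
move=> mr.
pose E : set ((spm * 'rV[R]_d) * 'rV[R]_d) := [set u | (edist u.2 u.1.2 < s)%R /\
  ~ closer (centers u.1.1) (r u.1.1) u.2 (edist u.2 u.1.2)].
have m1 : measurable_fun setT (fun u : (spm * 'rV[R]_d) * 'rV[R]_d => u.1.1).
  exact: measurableT_comp measurable_fst measurable_fst.
have m2 : measurable_fun setT (fun u : (spm * 'rV[R]_d) * 'rV[R]_d => u.1.2).
  exact: measurableT_comp measurable_snd measurable_fst.
have m3 : measurable_fun setT (fun u : (spm * 'rV[R]_d) * 'rV[R]_d => u.2).
  exact: measurable_snd.
have me := measurable_edist m3 m2.
have mE : measurable E.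
  apply: measurableI; first exact: measurable_ltr_set.
  by apply: measurableC; exact: measurable_closer_joint.
apply: (eq_measurable_fun _ _ (measurable_fun_xsection (@leb R d) mE)) => u _ /=.
by congr leb; apply/seteqP; split => y; rewrite /xsection/= inE.
Qed.

Let centers_countable pi : countable (centers pi).
Proof. exact/locally_finite_countable/centers_locally_finite. Qed.

(** As [avail] grows with the radius, admissible radii are closed downwards, and the supremum over
    reals reduces to a countable union over rationals. *)
Lemma measurable_radius_sup (r : spm -> 'rV[R]_d -> \bar R) : (0 < alpha)%R ->
  measurable_fun setT (fun p : spm * 'rV[R]_d => r p.1 p.2) ->
  measurable_fun setT (fun p : spm * 'rV[R]_d =>
    radius_sup alpha (centers p.1) (r p.1) p.2).
Proof.
move=> alpha0 mr; apply: measurable_fun_gt => c.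
have -> : [set p : spm * 'rV[R]_d | c%:E < radius_sup alpha (centers p.1) (r p.1) p.2] =
  \bigcup_(q in [set q : rat | (0 <= ratr q :> R)%R /\ (c < ratr q)%R])
    [set p : spm * 'rV[R]_d | leb (avail (centers p.1) (r p.1) p.2 (ratr q)) <= alpha%:E].
  apply/seteqP; split => [[pi z]|[pi z] [q [q0 cq] qa]] /=; last first.
    apply: (@lt_le_trans _ _ (ratr q)%:E); first by rewrite lte_fin.
    by apply: ereal_sup_ubound; exists (ratr q).
  move=> /ereal_sup_gt[_ [s [s0 sa] <-]]; rewrite lte_fin => cs.
  have [q [q0 cq qs]] : exists q : rat,
      [/\ (0 <= ratr q :> R)%R, (c < ratr q)%R & (ratr q <= s)%R].
    (* When [s = 0] no rational lies strictly between [Num.max 0 c] and [s], but then [c < 0] and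
       the rational [0] serves. *)
    move: s0; rewrite le_eqVlt => /predU1P[s0|s0].
      by exists 0%R; rewrite -s0 rmorph0 in cs *.
    have [|q] := @rat_in_itvoo _ (Num.max 0 c)%R s; first by rewrite gt_max s0.
    rewrite in_itv/= gt_max => /andP[/andP[q0 cq] qs].
    by exists q; split => //; exact: ltW.
  exists q; first by split.
  apply: le_trans sa; rewrite le_measure ?inE//; [exact: measurable_avail..|].
  exact: avail_le.
apply: countable_bigcup_measurable => [|q _].
  exact: (sub_countable (subset_card_le (@subsetT _ _))).
rewrite -[X in measurable X]setTI; apply: measurable_lee => //.
exact: leb_avail_measurable.
Qed.

Lemma measurable_radius_inf (r : spm -> 'rV[R]_d -> \bar R) :
  measurable_fun setT (fun p : spm * 'rV[R]_d => r p.1 p.2) ->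
  measurable_fun setT (fun p : spm * 'rV[R]_d =>
    radius_inf alpha (centers p.1) (r p.1) p.2).
Proof.
move=> mr; apply: measurable_fun_lt => c.
have -> : [set p : spm * 'rV[R]_d | radius_inf alpha (centers p.1) (r p.1) p.2 < c%:E] =
  \bigcup_(q in [set q : rat | (0 <= ratr q :> R)%R /\ (ratr q < c)%R])
    [set p : spm * 'rV[R]_d | alpha%:E <= leb (avail (centers p.1) (r p.1) p.2 (ratr q))].
  apply/seteqP; split => [[pi z]|[pi z] [q [q0 qc] qa]] /=; last first.
    apply: (@le_lt_trans _ _ (ratr q)%:E); last by rewrite lte_fin.
    by apply: ereal_inf_lbound; exists (ratr q).
  move=> /ereal_inf_lt[_ [s [s0 sa] <-]]; rewrite lte_fin => sc.
  have [q] := rat_in_itvoo sc; rewrite in_itv/= => /andP[sq qc].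
  exists q; first by split => //; exact: le_trans (ltW sq).
  apply: (le_trans sa); rewrite le_measure ?inE//; [exact: measurable_avail..|].
  exact/avail_le/ltW.
apply: countable_bigcup_measurable => [|q _].
  exact: (sub_countable (subset_card_le (@subsetT _ _))).
rewrite -[X in measurable X]setTI; apply: measurable_lee => //.
exact: leb_avail_measurable.
Qed.

Lemma measurable_rmax : (0 < alpha)%R ->
  measurable_fun setT (fun p : spm * 'rV[R]_d => rmax alpha (centers p.1) p.2).
Proof.
move=> alpha0; apply: measurable_fun_lt => c.
have -> : [set p : spm * 'rV[R]_d | rmax alpha (centers p.1) p.2 < c%:E] =
    \bigcup_n [set p : spm * 'rV[R]_d | rsup_seq alpha (centers p.1) n p.2 < c%:E].
  apply/seteqP; split => [p /= /ereal_inf_lt[_ [n _ <-]]|p [n _]] /=; first by exists n.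
  by apply: le_lt_trans; apply: ereal_inf_lbound; exists n.
apply: bigcupT_measurable => n; apply: measurable_lte_set => //.
elim: n => [|n ih]; first exact: measurable_cst.
exact: (@measurable_radius_sup (fun pi => rsup_seq alpha (centers pi) n)).
Qed.

Lemma measurable_rmin :
  measurable_fun setT (fun p : spm * 'rV[R]_d => rmin alpha (centers p.1) p.2).
Proof.
apply: measurable_fun_gt => c.
have -> : [set p : spm * 'rV[R]_d | c%:E < rmin alpha (centers p.1) p.2] =
    \bigcup_n [set p : spm * 'rV[R]_d | c%:E < rinf_seq alpha (centers p.1) n p.2].
  apply/seteqP; split => [p /= /ereal_sup_gt[_ [n _ <-]]|p [n _]] /=; first by exists n.
  by move=> h; apply: (lt_le_trans h); apply: ereal_sup_ubound; exists n.
apply: bigcupT_measurable => n; apply: measurable_lte_set => //.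
elim: n => [|n ih]; first exact: measurable_cst.
exact: (@measurable_radius_inf (fun pi => rinf_seq alpha (centers pi) n)).
Qed.

End radii_measurability.

(** The preimage splits according to whether a site has exactly one [near] center, none, or
    several. *)
Lemma measurable_alloc (r : spm -> 'rV[R]_d -> \bar R) :
  measurable_fun setT (fun p : spm * 'rV[R]_d => r p.1 p.2) ->
  measurable_fun setT (fun p : spm * 'rV[R]_d => alloc (centers p.1) (r p.1) p.2).
Proof.
move=> mr.
pose S := (spm * 'rV[R]_d)%type.
have mS1 : measurable_fun setT (fun u : S * 'rV[R]_d => u.1.1).
  exact: measurableT_comp measurable_fst measurable_fst.
have mS2 : measurable_fun setT (fun u : S * 'rV[R]_d => u.1.2).
  exact: measurableT_comp measurable_snd measurable_fst.
have mS3 : measurable_fun setT (fun u : S * 'rV[R]_d => u.2).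
  exact: measurable_snd.
pose N : set (S * 'rV[R]_d) := [set u | near (centers u.1.1) (r u.1.1) u.1.2 u.2].
have mN : measurable N by exact: measurable_near_joint.
have m1 : measurable_fun setT (@fst spm 'rV[R]_d) by exact: measurable_fst.
have mEx (B : set 'rV[R]_d) : measurable B ->
    measurable [set p : S | exists2 xi, near (centers p.1) (r p.1) p.2 xi & B xi].
  move=> mB.
  have mNB : measurable (N `&` [set u | B u.2]).
    by apply: measurableI => //; exact: measurable_preimageT mS3 mB.
  have := measurable_exists_center m1 mNB; congr measurable.
  apply/seteqP; split => p /= [xi].
    by move=> _ [nxi Bxi]; exists xi.
  by move=> nxi Bxi; exists xi => //; case: nxi.
have mEx2 : measurable [set p : S | exists xi eta,
    [/\ near (centers p.1) (r p.1) p.2 xi, near (centers p.1) (r p.1) p.2 eta & xi <> eta]].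
  (* Distinctness of two centers is put as a nonzero distance, which is measurable in the pair; each
     quantifier then passes through [measurable_exists_center]. *)
  pose E2 : set (S * 'rV[R]_d) := [set u | N u /\ 
     exists2 eta, centers u.1.1 eta & N (u.1, eta) /\ edist u.2 eta <> 0%R].
  have mE2 : measurable E2.
    apply: measurableI => //.
    have mf : measurable_fun setT (fun w : (S * 'rV[R]_d) * 'rV[R]_d => (w.1.1, w.2)).
      apply: measurable_fun_pair; last exact: measurable_snd.
      exact: measurableT_comp measurable_fst measurable_fst.
    have mE3 : measurable ([set w : (S * 'rV[R]_d) * 'rV[R]_d | N (w.1.1, w.2)] `&`
        [set w | edist w.1.2 w.2 <> 0%R]).
      apply: measurableI; first exact: measurable_preimageT mf mN.
      apply: (@measurable_preimageT _ _ _ _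
        (fun w : (S * 'rV[R]_d) * 'rV[R]_d => edist w.1.2 w.2) [set~ 0%R]).
        apply: measurable_edist; last exact: measurable_snd.
        exact: measurableT_comp measurable_snd measurable_fst.
      by apply: measurableC; exact: measurable_set1.
    exact: (measurable_exists_center mS1 mE3).
  have := measurable_exists_center m1 mE2; congr measurable.
  apply/seteqP; split => [p /= [xi _ [nxi [eta _ [neta ne]]]]|p /= [xi [eta [nxi neta ne]]]].
    by exists xi, eta; split => // xieta; apply: ne; rewrite xieta edistxx.
  exists xi; first by case: nxi.
  split => //; exists eta; first by case: neta.
  by split => // /edist_eq0.
move=> _ A mA; rewrite setTI.
set E2 := (X in measurable X) in mEx2.
pose U := [set p : S | exists2 xi, near (centers p.1) (r p.1) p.2 xi & setT xi].
have mU : measurable U by exact: mEx.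
rewrite (_ : _ @^-1` A =
    ([set p : S | exists2 xi, near (centers p.1) (r p.1) p.2 xi & (Center @^-1` A) xi] `\` E2)
    `|` ((if `[< A Infty >] then ~` U else set0) `|` (if `[< A Delta >] then E2 else set0))).
  apply: measurableU; first by apply: measurableD => //; exact: mEx.
  apply: measurableU; case: ifP => _ //; exact: measurableC.
apply/seteqP; split => p /=.
  have [[xi -> [nxi u]]|[-> no]|[-> [y [z [ny nz yz]]]]] := allocP (centers p.1) (r p.1) p.2.
  - move=> Axi; left; split; first by exists xi.
    by move=> [y [z [/u -> /u ->]]].
  - by move=> Ai; right; left; rewrite asboolT// => -[xi /no].
  - by move=> Ad; right; right; rewrite asboolT//; exists y, z.
have [[xi -> [nxi u]]|[-> no]|[-> [y [z [ny nz yz]]]]] := allocP (centers p.1) (r p.1) p.2.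
- move=> [[[y /u -> //]]|[]]; case: asboolP => _ //.
    by move=> nU; exfalso; apply: nU; exists xi.
  by move=> [y [z [/u -> /u ->]]].
- move=> [[[xi /no//]]|[]]; case: asboolP => // _.
  by move=> [y [z [/no]]].
- move=> [[_ []]|[]]; [by exists y, z| |]; case: asboolP => // _.
  by move=> nU; exfalso; apply: nU; exists y.
Qed.

End point_measures.

(** * Mass transport and uniqueness *)

Lemma integral_measure_preserving d (T : measurableType d) (R : realType)
    (mu : {measure set T -> \bar R}) (phi : T -> T) (f : T -> \bar R) :
  measurable_fun setT phi ->
  (forall A, measurable A -> mu (phi @^-1` A) = mu A) ->
  measurable_fun setT f -> (forall x, 0 <= f x) ->
  \int[mu]_x f (phi x) = \int[mu]_x f x.
Proof.
move=> mphi muphi mf f0.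
pose m := measure_function_pushforward__canonical__measure_function_Measure mu mphi.
transitivity (\int[m]_x f x).
  by apply/esym/(ge0_integral_pushforward mphi) => //; exact: measurableT.
by apply: eq_measure_integral => B mB _; exact: muphi.
Qed.

Section mass_transport.
Context (R : realType) (d : nat).
Local Notation spm := (simple_point_measure R d).
Local Notation V := 'rV[R]_d.
Context (P : probability spm R) (Pinv : translation_invariant P).

Lemma spm_sigma_finite (pi : spm) : exists m : {sigma_finite_measure set V -> \bar R},
  forall A, m A = tame pi A.
Proof.
apply: sigma_finite_bundle; exists (fun n => eball 0 n%:R); first by rewrite eball_cover.
by move=> n; split; [exact: measurable_eball|exact: tame_tame].
Qed.

Lemma tame_imageE (T : isometry R d) pi A : tame (spm_image T pi) A = tame pi (T @^-1` A).
Proof.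
rewrite /tame; have [tp|ntp] := pselect (tame_spm pi).
  by rewrite !mem_set//; exact/tame_spm_image.
by rewrite !memNset// => /tame_spm_image.
Qed.

(** [F (pi, x, xi)] is read as: the site [x] sends mass to the center [xi]. Sites are weighted by
    Lebesgue measure, centers are counted. *)
Context (F : set ((spm * V) * V)) (mF : measurable F)
  (Finv : forall v pi x xi,
    F (spm_image (translation v) pi, (x + v)%R, (xi + v)%R) <-> F (pi, x, xi)).
Context (Q : set V) (mQ : measurable Q) (Qfin : leb Q \is a fin_num) (Q0 : leb Q != 0).

Definition shifted_site := ((spm * V) * V)%type.
Let M1 : measurable_fun setT (fun w : shifted_site * V => w.1.1.1).
Proof. exact: measurableT_comp measurable_fst (measurableT_comp measurable_fst measurable_fst). Qed.
Let M2 : measurable_fun setT (fun w : shifted_site * V => w.1.1.2).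
Proof. exact: measurableT_comp measurable_snd (measurableT_comp measurable_fst measurable_fst). Qed.
Let M3 : measurable_fun setT (fun w : shifted_site * V => w.1.2).
Proof. exact: measurableT_comp measurable_snd measurable_fst. Qed.
Let M4 : measurable_fun setT (fun w : shifted_site * V => w.2).
Proof. exact: measurable_snd. Qed.

(* The four coordinates of [w : shifted_site * V] are the point measure, the
   shift, the site and the center. *)
Definition sent_config : set (shifted_site * V) :=
  [set w | Q w.1.2 /\ Q (w.2 - w.1.1.2)%R /\ F (w.1.1.1, w.1.2, w.2)].
Definition received_config : set (shifted_site * V) :=
  [set w | Q (w.1.2 + w.1.1.2)%R /\ Q w.2 /\ F (w.1.1.1, w.1.2, w.2)].

Let mFW : measurable [set w : shifted_site * V | F (w.1.1.1, w.1.2, w.2)].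
Proof.
have m : measurable_fun setT (fun w : shifted_site * V => (w.1.1.1, w.1.2, w.2)).
  by apply: measurable_fun_pair => //; apply: measurable_fun_pair.
exact: measurable_preimageT m mF.
Qed.

Let measurable_sent_config : measurable sent_config.
Proof.
apply: measurableI; first exact: measurable_preimageT M3 mQ.
apply: measurableI => //; apply: measurable_preimageT mQ.
by apply: measurable_addrV => //; exact: measurable_opprV.
Qed.

Let measurable_received_config : measurable received_config.
Proof.
apply: measurableI; first by apply: measurable_preimageT mQ; exact: measurable_addrV.
apply: measurableI => //; exact: measurable_preimageT M4 mQ.
Qed.

Definition center_count (E : set (shifted_site * V)) (w : shifted_site) : \bar R :=
  tame w.1.1 [set xi | E (w, xi)].

Let measurable_center_count E : measurable E -> measurable_fun setT (center_count E).
Proof.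
move=> mE.
have mt : measurable_fun setT (fun w : shifted_site => tame w.1.1).
  exact: measurableT_comp (@measurable_tame R d) (measurableT_comp measurable_fst measurable_fst).
exact: (measurable_spm_section mt (fun w => tame_tame w.1.1) mE).
Qed.

(** With [sent_config] and shift [v], the mass going from [Q] to [Q + v]; with [received_config],
    from [Q - v] to [Q]. Integrating over all shifts, instead of summing over a lattice, allows any
    [Q] of finite positive volume. *)
Definition transport (E : set (shifted_site * V)) (u : spm * V) : \bar R :=
  \int[@leb R d]_x center_count E (u, x).

Let measurable_transport E : measurable E -> measurable_fun setT (transport E).
Proof.
move=> mE; apply: (@measurable_fun_fubini_tonelli_F _ _ _ _ _ (@leb R d) (center_count E)).
  exact: measurable_center_count.
by move=> w; exact: measure_ge0.
Qed.

Let swap E pi : measurable E ->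
  \int[@leb R d]_v transport E (pi, v) =
  \int[@leb R d]_x \int[@leb R d]_v center_count E (pi, v, x).
Proof.
move=> mE; apply: (sfinite_Fubini (@leb R d) (@leb R d)
  (fun u : V * V => center_count E (pi, u.1, u.2))).
  by move=> u; exact: measure_ge0.
have m : measurable_fun setT (fun u : V * V => (pi, u.1, u.2)).
  apply: measurable_fun_pair; last exact: measurable_snd.
  by apply: measurable_fun_pair; [exact: measurable_cst|exact: measurable_fst].
exact: measurableT_comp (measurable_center_count mE) m.
Qed.

Definition sent pi : \bar R := \int[@leb R d]_x tame pi [set xi | Q x /\ F (pi, x, xi)].
Definition received pi : \bar R := \int[@leb R d]_x tame pi [set xi | Q xi /\ F (pi, x, xi)].

Let measurable_Fsec pi x : measurable [set xi | F (pi, x, xi)].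
Proof.
have m : measurable_fun setT (fun xi : V => (pi, x, xi)).
  by apply: measurable_fun_pair; [exact: measurable_cst|exact: measurable_id].
exact: measurable_preimageT m mF.
Qed.

Let leb_reflection (xi : V) : leb [set v | Q (xi - v)%R] = leb Q.
Proof.
have iso x y : edist (xi - x)%R (xi - y)%R = edist x y.
  by rewrite edistC /edist opprB addrC addrA subrK.
by rewrite -(leb_isometry (Isometry iso) mQ).
Qed.

Let leb_shift (x : V) : leb [set v | Q (x + v)%R] = leb Q.
Proof.
by rewrite -(leb_translation x mQ); congr leb; apply/seteqP; split => v /=; rewrite addrC.
Qed.

Lemma measurable_sent_density pi (B : V -> Prop) : measurable B ->
  measurable_fun setT (fun x : V => tame pi [set xi | B x /\ F (pi, x, xi)]).
Proof.
move=> mB.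
have m : measurable_fun setT (fun u : V * V => (pi, u.1, u.2)).
  apply: measurable_fun_pair; last exact: measurable_snd.
  by apply: measurable_fun_pair; [exact: measurable_cst|exact: measurable_fst].
have mE : measurable [set u : V * V | B u.1 /\ F (pi, u.1, u.2)].
  apply: measurableI; last exact: measurable_preimageT m mF.
  exact: (measurable_preimageT measurable_fst mB).
exact: (measurable_spm_section (measurable_cst (tame pi)) (fun=> tame_tame pi) mE).
Qed.

(** For a fixed site, exchange the count of centers with the integral over [v]: each [xi] then
    contributes the volume of [xi - Q], which is [leb Q]. *)
Let transport_sent pi : \int[@leb R d]_v transport sent_config (pi, v) = sent pi * leb Q.
Proof.
rewrite swap// /sent -ge0_integralZr//; last exact: measurable_sent_density.
apply: eq_integral => x _.
have [m mE] := spm_sigma_finite pi.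
have mm : measurable_fun setT (fun u : V * V => (pi, u.1, x, u.2)).
  apply: measurable_fun_pair; last exact: measurable_snd.
  apply: measurable_fun_pair; last exact: measurable_cst.
  by apply: measurable_fun_pair; [exact: measurable_cst|exact: measurable_fst].
rewrite /center_count/=; under eq_integral do rewrite -mE.
rewrite (@sfinite_fubini_set _ _ _ _ _ (@leb R d) m
  [set u | sent_config (pi, u.1, x, u.2)]); last first.
  exact: measurable_preimageT mm measurable_sent_config.
rewrite -mE; apply: ge0_integral_indic_cst => //.
- have [Qx|nQx] := pselect (Q x).
    by rewrite (_ : [set xi | _] = [set xi | F (pi, x, xi)])//; apply/seteqP; split => xi // [].
  by rewrite (_ : [set xi | _] = set0)// -subset0 => xi [].
- move=> xi [Qx Fx]; rewrite -(leb_reflection xi); congr leb.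
  by apply/seteqP; split => v /= => [[_ []]|].
- move=> xi nQF; rewrite (_ : [set v | _] = set0) ?measure0// -subset0 => v [Qx [_ Fx]].
  exact: nQF.
Qed.

(** The shift occurs only in [Q (x + v)], so it integrates to [leb Q] while the count of centers is
    a constant factor. *)
Let transport_received pi :
  \int[@leb R d]_v transport received_config (pi, v) = received pi * leb Q.
Proof.
have mr : measurable_fun setT (fun x : V => tame pi [set xi | Q xi /\ F (pi, x, xi)]).
  have m : measurable_fun setT (fun u : V * V => (pi, u.1, u.2)).
    apply: measurable_fun_pair; last exact: measurable_snd.
    by apply: measurable_fun_pair; [exact: measurable_cst|exact: measurable_fst].
  have mE : measurable [set u : V * V | Q u.2 /\ F (pi, u.1, u.2)].
    apply: measurableI; last exact: measurable_preimageT m mF.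
    exact: (measurable_preimageT measurable_snd mQ).
  exact: (measurable_spm_section (measurable_cst (tame pi)) (fun=> tame_tame pi) mE).
rewrite swap// /received -ge0_integralZr//.
apply: eq_integral => x _.
rewrite muleC -(leb_shift x); apply: ge0_integral_indic_cst => //.
- rewrite (_ : [set v | _] = (fun v => v + x)%R @^-1` Q).
    exact: measurable_preimageT (measurable_isometry (translation x)) mQ.
  by apply/seteqP; split => v /=; rewrite addrC.
- move=> v Qv; rewrite /center_count/=; congr (tame pi _).
  by apply/seteqP; split => xi /= => [[_ []]|[]].
- move=> v nQv; rewrite /center_count/= (_ : [set xi | _] = set0) ?measure0//.
  by rewrite -subset0 => xi [].
Qed.

(** Adding [v] to [pi], [x] and [xi] turns [Q (x + v)] and [Q xi] into [Q x] and [Q (xi - v)], and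
    preserves [F] and Lebesgue measure. *)
Let transport_translate pi v :
  transport sent_config (spm_image (translation v) pi, v) = transport received_config (pi, v).
Proof.
rewrite /transport -(@integral_measure_preserving _ _ _ (@leb R d) (fun x => x + v)%R); first last.
- by move=> x; exact: measure_ge0.
- have m : measurable_fun setT (fun x : V => (spm_image (translation v) pi, v, x)).
    by apply: measurable_fun_pair; [exact: measurable_cst|exact: measurable_id].
  exact: measurableT_comp (measurable_center_count measurable_sent_config) m.
- by move=> A mA; exact: leb_translation.
- exact: (measurable_isometry (translation v)).
apply: eq_integral => x _; rewrite /center_count/= tame_imageE; congr (tame pi _).
apply/seteqP; split => xi /=; rewrite /preimage /translation /sent_config/= ?addrK;
  move=> [Qx [Qxi Fx]]; split => //; split => //; exact/(Finv v).
Qed.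

Lemma measurable_sent : measurable_fun setT sent.
Proof.
have mE : measurable [set u : (spm * V) * V | Q u.1.2 /\ F u].
  apply: measurableI => //; apply: measurable_preimageT mQ.
  exact: measurableT_comp measurable_snd measurable_fst.
have mt : measurable_fun setT (fun u : spm * V => tame u.1).
  exact: measurableT_comp (@measurable_tame R d) measurable_fst.
have := measurable_spm_section mt (fun u => tame_tame u.1) mE.
move/(@measurable_fun_fubini_tonelli_F _ _ _ _ _ (@leb R d)); apply => u.
exact: measure_ge0.
Qed.

Lemma measurable_received : measurable_fun setT received.
Proof.
have mE : measurable [set u : (spm * V) * V | Q u.2 /\ F u].
  by apply: measurableI => //; apply: measurable_preimageT measurable_snd mQ.
have mt : measurable_fun setT (fun u : spm * V => tame u.1).
  exact: measurableT_comp (@measurable_tame R d) measurable_fst.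
have := measurable_spm_section mt (fun u => tame_tame u.1) mE.
move/(@measurable_fun_fubini_tonelli_F _ _ _ _ _ (@leb R d)); apply => u.
exact: measure_ge0.
Qed.

(** For each shift the two transports have equal expectation, by [transport_translate] and
    invariance of [P]. Integrating over the shifts gives the claim multiplied by [leb Q], which is
    finite and nonzero and cancels. *)
Lemma mass_transport : \int[P]_pi sent pi = \int[P]_pi received pi.
Proof.
have Qgt0 : 0 < leb Q by rewrite lt0e Q0 measure_ge0.
have sw E : measurable E -> \int[P]_pi \int[@leb R d]_v transport E (pi, v) =
    \int[@leb R d]_v \int[P]_pi transport E (pi, v).
  move=> mE; apply: (sfinite_Fubini P (@leb R d) (transport E)); last exact: measurable_transport.
  by move=> u; apply: integral_ge0 => x _; exact: measure_ge0.
have key : \int[P]_pi \int[@leb R d]_v transport sent_config (pi, v) =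
    \int[P]_pi \int[@leb R d]_v transport received_config (pi, v).
  apply: (etrans (sw _ measurable_sent_config)).
  apply/esym/(etrans (sw _ measurable_received_config))/esym.
  apply: eq_integral => v _.
  rewrite -(@integral_measure_preserving _ _ _ P (spm_image (translation v))); first last.
  - by move=> u; apply: integral_ge0 => x _; exact: measure_ge0.
  - have m : measurable_fun setT (fun pi : spm => (pi, v)).
      by apply: measurable_fun_pair; [exact: measurable_id|exact: measurable_cst].
    exact: measurableT_comp (measurable_transport measurable_sent_config) m.
  - by move=> A mA; exact: Pinv.
  - exact: measurable_spm_image.
  by apply: eq_integral => pi _; rewrite transport_translate.
have s0 pi : 0 <= sent pi by apply: integral_ge0 => x _; exact: measure_ge0.
have r0 pi : 0 <= received pi by apply: integral_ge0 => x _; exact: measure_ge0.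
have sE : \int[P]_pi (sent pi * leb Q) = (\int[P]_pi sent pi) * leb Q.
  exact: (@ge0_integralZr _ _ _ P setT measurableT sent measurable_sent _
    (fun pi _ => s0 pi) (ltW Qgt0)).
have rE : \int[P]_pi (received pi * leb Q) = (\int[P]_pi received pi) * leb Q.
  exact: (@ge0_integralZr _ _ _ P setT measurableT received measurable_received _
    (fun pi _ => r0 pi) (ltW Qgt0)).
have h : (\int[P]_pi sent pi) * leb Q = (\int[P]_pi received pi) * leb Q.
  rewrite -sE -rE; apply: etrans (etrans key _).
    by apply: eq_integral => pi _; rewrite transport_sent.
  by apply: eq_integral => pi _; rewrite transport_received.
exact: mule_cancelr h.
Qed.

End mass_transport.

Lemma measurable_leb_section disp (T : measurableType disp) (R : realType) (d : nat)
    (E : set (T * 'rV[R]_d)) : measurable E ->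
  measurable_fun setT (fun t => leb [set x | E (t, x)]).
Proof.
move=> mE; apply: (eq_measurable_fun _ _ (measurable_fun_xsection (@leb R d) mE)) => u _ /=.
by congr leb; apply/seteqP; split => y; rewrite /xsection/= inE.
Qed.

(** * Almost sure local finiteness *)

Section tame_almost_surely.
Context (R : realType) (d : nat).
Local Notation spm := (simple_point_measure R d).
Local Notation Q1 := (@unit_cube R d).
Context (P : probability spm R) (Pinv : translation_invariant P).

Lemma measurable_unit_cube : measurable Q1.
Proof.
rewrite (_ : Q1 = \bigcap_(i in [set: 'I_d])
    ((fun x : 'rV[R]_d => x ord0 i) @^-1` `[0%R, 1%R[%classic)); last first.
  by apply/seteqP; split => x /= h i; [move=> _|]; have := h i; rewrite /= in_itv/=; [|exact].
apply: fin_bigcap_measurable => // i _.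
by rewrite -[X in measurable X]setTI; apply: measurable_coord.
Qed.

(** Finite intensity makes the mass of the unit cube almost surely finite, invariance extends this
    to every translate, and finitely many translates cover a ball. *)
Lemma ae_tame_spm : intensity P < +oo -> {ae P, forall pi : spm, tame_spm pi}.
Proof.
move=> Ifin.
have m0 := measurable_spm_eval measurable_unit_cube.
have cube_fin : {ae P, forall pi : spm, pi Q1 < +oo}.
  have : P.-integrable setT (fun pi : spm => pi Q1).
    apply/integrableP; split => //; apply: le_lt_trans Ifin.
    rewrite le_eqVlt; apply/orP; left; apply/eqP.
    by apply: eq_integral => pi _; rewrite gee0_abs.
  move=> /(integrable_ae measurableT); apply: filterS => pi /(_ I).
  by rewrite ge0_fin_numE.
have shift_fin (v : 'rV[R]_d) :
    {ae P, forall pi : spm, pi (translation v @^-1` Q1) < +oo}.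
  have mv := @measurable_spm_image R d (translation v).
  have mB : measurable [set pi : spm | pi Q1 = +oo].
    exact: (measurable_preimageT m0 (emeasurable_set1 +oo)).
  exists (spm_image (translation v) @^-1` [set pi : spm | pi Q1 = +oo]).
  split; first exact: measurable_preimageT mv mB.
    rewrite -[LHS]/(P _) (Pinv v mB); case: cube_fin => N [mN N0 cN].
    apply: (subset_measure0 mB mN) N0 => pi /= h; apply: cN => /=.
    by rewrite h.
  by move=> pi /= /negP; rewrite -leNgt leye_eq => /eqP.
apply: (@filterS _ _ _ (fun pi : spm => forall n : nat, pi (eball 0 n%:R) < +oo)) => //.
apply: ae_foralln => n.
(* The cube indexed by [f] has sides from [f i - n] to [f i - n + 1]; as [f i] runs from 0 to [2n],
   these cover the ball of radius [n]. *)
pose I := {ffun 'I_d -> 'I_(n + n).+1}.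
pose v (f : I) : 'rV[R]_d := (\row_i (n%:R - (f i)%:R))%R.
have : {ae P, forall pi : spm, forall f : I, setT f ->
    pi (translation (v f) @^-1` Q1) < +oo}.
  apply: (ae_countable (P := fun (f : I) (pi : spm) =>
    pi (translation (v f) @^-1` Q1) < +oo)) => //.
  exact: countableP.
apply: filterS => pi pif.
have mf f : measurable (translation (v f) @^-1` Q1).
  exact: measurable_preimageT (measurable_isometry _) measurable_unit_cube.
pose A := \big[setU/set0]_(f : I) (translation (v f) @^-1` Q1).
have [mA Afin] : measurable A /\ pi A < +oo.
  apply: (big_ind (fun B : set 'rV[R]_d => measurable B /\ pi B < +oo)).
  - by split => //; rewrite measure0.
  - move=> B C [mB fB] [mC fC]; split; first exact: measurableU.
    by apply: (le_lt_trans (measureU2 pi mB mC)); exact: lte_add_pinfty.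
  - by move=> f _; split => //; exact: pif.
apply: le_lt_trans Afin; rewrite le_measure ?inE//; first exact: measurable_eball.
move=> x; rewrite /eball/= edist0 => xn.
have xi i : (0 <= x ord0 i + n%:R < (n + n)%:R)%R.
  have := le_lt_trans (coord_le_enorm x i) xn.
  by rewrite ltr_norml natrD => /andP[h1 h2]; apply/andP; split; lra.
have ti i : (Num.Def.truncn (x ord0 i + n%:R)%R < (n + n).+1)%N.
  have /andP[h0 h1] := xi i.
  by rewrite ltnS -(ler_nat R) (le_trans _ (ltW h1))// truncn_le.
rewrite /A -bigcup_seq; exists [ffun i => Ordinal (ti i)] => /=; first exact: mem_index_enum.
move=> i; rewrite /translation /v/= !mxE ffunE/=.
have /andP[h0 h1] := xi i.
have /andP[t0 t1] := truncn_itv h0.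
apply/andP; split; first by lra.
by move: t1; rewrite -natr1; lra.
Qed.

End tame_almost_surely.

(** * Comparison of the two extremal allocations *)

Section comparison.
Context (R : realType) (d : nat) (alpha : R) (d1 : (1 <= d)%N) (alpha0 : (0 < alpha)%R).
Local Notation spm := (simple_point_measure R d).
Local Notation V := 'rV[R]_d.
Context (P : probability spm R) (Pinv : translation_invariant P).

(* [r pi] is one of the two extremal radius functions of the centers of [pi]. *)
Section within.
Context (r : spm -> V -> \bar R) (t : R)
  (mr : measurable_fun setT (fun p : spm * V => r p.1 p.2))
  (rinv : forall v pi z, r (spm_image (translation v) pi) (translation v z) = r pi z).

(** The cutoff [t] records how near a site is served; knowing [within] for all rational [t]
    determines the serving distance. *)
Definition close_pair : set ((spm * V) * V) :=
  [set u | near (centers u.1.1) (r u.1.1) u.1.2 u.2 /\ (edist u.1.2 u.2 < t)%R].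

Definition within : set (spm * V) :=
  [set u | exists xi, near (centers u.1) (r u.1) u.2 xi /\ (edist u.2 xi < t)%R].

Lemma measurable_close_pair : measurable close_pair.
Proof.
have m2 : measurable_fun setT (fun u : (spm * V) * V => u.1.2).
  exact: measurableT_comp measurable_snd measurable_fst.
have m1 : measurable_fun setT (fun u : (spm * V) * V => u.1.1).
  exact: measurableT_comp measurable_fst measurable_fst.
apply: measurableI; first exact: (measurable_near_joint mr m1 m2 measurable_snd).
apply: measurable_ltr_set; last exact: measurable_cst.
exact: measurable_edist m2 measurable_snd.
Qed.

Lemma close_pair_translation v pi x xi :
  close_pair (spm_image (translation v) pi, (x + v)%R, (xi + v)%R) <->
  close_pair (pi, x, xi).
Proof.
rewrite /close_pair/= centers_image edist_translation.
have h := near_image (T := translation v) (centers pi) x xi (rinv v pi).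
by split => -[nx xt]; split => //; apply/h.
Qed.

Lemma measurable_within : measurable within.
Proof.
have m1 : measurable_fun setT (@fst spm V) by exact: measurable_fst.
have := measurable_exists_center m1 measurable_close_pair.
congr measurable; apply/seteqP; split => u /=.
  by move=> [xi _ [nxi xt]]; exists xi.
by move=> [xi [nxi xt]]; exists xi => //; case: nxi.
Qed.

(** Almost every site has at most one [near] center, so the count of centers is the indicator of
    [within]. *)
Lemma sentE (Q : set V) pi : measurable Q ->
  \int[@leb R d]_x tame pi [set xi | Q x /\ close_pair (pi, x, xi)] =
  leb [set x | Q x /\ within (pi, x)].
Proof.
move=> mQ; set A := [set x | _].
have mA : measurable A.
  apply: measurableI => //.
  have m : measurable_fun setT (fun x : V => (pi, x)).
    by apply: measurable_fun_pair; [exact: measurable_cst|exact: measurable_id].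
  exact: measurable_preimageT m measurable_within.
rewrite -[RHS]mul1e -integral_cst// [RHS]integral_mkcond.
apply: ge0_ae_eq_integral => //.
- exact: (measurable_sent_density measurable_close_pair).
- by apply/(measurable_restrictT _ mA); exact: measurable_cst.
- by move=> x _; rewrite patchE; case: ifP.
have lf := centers_locally_finite pi.
apply: filterS (ae_generic lf) => x gx _; rewrite patchE.
case: ifPn => [/set_mem[Qx [xi [nxi xt]]]|/negP nA].
  apply: (@spm_unique _ _ _ _ xi) => //; first by case: nxi.
  by move=> w _ [_ [nw _]]; exact: generic_near gx nw nxi.
rewrite (_ : [set xi | _] = set0) ?measure0// -subset0 => xi [Qx [nxi xt]].
by apply: nA; rewrite inE; split => //; exists xi.
Qed.

Lemma within_mass_transport (Q : set V) :
  measurable Q -> leb Q \is a fin_num -> leb Q != 0 ->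
  \int[P]_pi leb [set x | Q x /\ within (pi, x)] =
  \int[P]_pi \int[@leb R d]_x tame pi [set xi | Q xi /\ close_pair (pi, x, xi)].
Proof.
move=> mQ Qfin Q0.
apply: etrans (mass_transport Pinv measurable_close_pair close_pair_translation mQ Qfin Q0).
by apply: eq_integral => pi _; rewrite -sentE.
Qed.

Lemma receivedE (Q : set V) pi (m : {sigma_finite_measure set V -> \bar R}) :
  measurable Q -> (forall A, m A = tame pi A) ->
  \int[@leb R d]_x tame pi [set xi | Q xi /\ close_pair (pi, x, xi)] =
  \int[m]_xi leb [set x | Q xi /\ close_pair (pi, x, xi)].
Proof.
move=> mQ mE.
have mm : measurable_fun setT (fun u : V * V => (pi, u.1, u.2)).
  apply: measurable_fun_pair; last exact: measurable_snd.
  by apply: measurable_fun_pair; [exact: measurable_cst|exact: measurable_fst].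
under eq_integral do rewrite -mE.
rewrite (@sfinite_fubini_set _ _ _ _ _ (@leb R d) m
  [set u | Q u.2 /\ close_pair (pi, u.1, u.2)])//.
apply: measurableI; last exact: measurable_preimageT mm measurable_close_pair.
exact: (measurable_preimageT measurable_snd mQ).
Qed.

Lemma measurable_received_density (Q : set V) pi : measurable Q ->
  measurable_fun setT (fun xi : V => leb [set x | Q xi /\ close_pair (pi, x, xi)]).
Proof.
move=> mQ.
have mm : measurable_fun setT (fun u : V * V => (pi, u.2, u.1)).
  apply: measurable_fun_pair; last exact: measurable_fst.
  by apply: measurable_fun_pair; [exact: measurable_cst|exact: measurable_snd].
apply: (@measurable_leb_section _ _ _ _ [set u : V * V | Q u.1 /\ close_pair (pi, u.2, u.1)]).
apply: measurableI; last exact: measurable_preimageT mm measurable_close_pair.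
exact: (measurable_preimageT measurable_fst mQ).
Qed.

End within.

Let rM (pi : spm) : V -> \bar R := rmax alpha (centers pi).
Let rm (pi : spm) : V -> \bar R := rmin alpha (centers pi).
Let mrM : measurable_fun setT (fun p : spm * V => rM p.1 p.2).
Proof. exact: measurable_rmax. Qed.
Let mrm : measurable_fun setT (fun p : spm * V => rm p.1 p.2).
Proof. exact: measurable_rmin. Qed.
Let centers_countable (pi : spm) : countable (centers pi).
Proof. exact/locally_finite_countable/centers_locally_finite. Qed.
Let rMinv v pi z : rM (spm_image (translation v) pi) (translation v z) = rM pi z.
Proof. by rewrite /rM centers_image rmax_image. Qed.
Let rminv v pi z : rm (spm_image (translation v) pi) (translation v z) = rm pi z.
Proof. by rewrite /rm centers_image rmin_image. Qed.

(** A center accepting [x] under [rmin] accepts it under [rmax], so the nearest one accepting it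
    under [rmax] is no farther. *)
Let within_le t u : within rm t u -> within rM t u.
Proof.
case: u => pi x [xi [[Xxi xr nc] xt]] /=.
have lf := centers_locally_finite pi.
have xr' : (edist x xi)%:E < rM pi xi by apply: lt_le_trans xr _; exact: rmin_le_rmax.
have [z nz zxi] := near_exists lf Xxi xr'.
by exists z; split => //; exact: le_lt_trans zxi xt.
Qed.

(** Pointwise [f = g + h], so sites are served more under [rmax]. Mass transport rewrites both
    expectations as mass received, where [leb_near_rmax_rmin] gives the opposite inequality. Hence
    [h] has zero expectation. *)
Lemma ae_within_eq (Q : set V) t : measurable Q -> leb Q \is a fin_num ->
  {ae P, forall pi,
    leb [set x | Q x /\ within rM t (pi, x) /\ ~ within rm t (pi, x)] = 0}.
Proof.
move=> mQ Qfin.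
have mW (E : set (spm * V)) : measurable E -> measurable [set u : spm * V | Q u.2 /\ E u].
  by move=> mE; apply: measurableI => //; exact: (measurable_preimageT measurable_snd mQ).
have mWs (E : set (spm * V)) pi : measurable E -> measurable [set x | E (pi, x)].
  move=> mE; have m : measurable_fun setT (fun x : V => (pi, x)).
    by apply: measurable_fun_pair; [exact: measurable_cst|exact: measurable_id].
  exact: measurable_preimageT m mE.
have mM := mW _ (measurable_within t mrM).
have mm := mW _ (measurable_within t mrm).
have mMm : measurable [set u : spm * V | Q u.2 /\ within rM t u /\ ~ within rm t u].
  apply: (mW [set u | within rM t u /\ ~ within rm t u]); apply: measurableI.
    exact: measurable_within.
  by apply: measurableC; exact: measurable_within.
have [Q0|/eqP Q0] := pselect (leb Q = 0).
  apply: aeW => pi; apply: (subset_measure0 (mWs _ pi mMm) mQ) Q0.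
  by move=> x [].
pose f pi := leb [set x | Q x /\ within rM t (pi, x)].
pose g pi := leb [set x | Q x /\ within rm t (pi, x)].
pose h pi := leb [set x | Q x /\ within rM t (pi, x) /\ ~ within rm t (pi, x)].
have mf : measurable_fun setT f by exact: measurable_leb_section mM.
have mg : measurable_fun setT g by exact: measurable_leb_section mm.
have mh : measurable_fun setT h by exact: measurable_leb_section mMm.
have fgh pi : f pi = g pi + h pi.
  rewrite /f /g /h -measureU; [|exact: (mWs _ pi mm)|exact: (mWs _ pi mMm)|].
    congr leb; apply/seteqP; split => [x [Qx wM]|x [[Qx wm]|[Qx [wM _]]]]; last 2 first.
    - by split => //; exact: within_le.
    - by [].
    by have [wm|nwm] := pselect (within rm t (pi, x)); [left|right].
  by rewrite -subset0 => x [[_ wm] [_ [_ nwm]]].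
have fleg : \int[P]_pi f pi <= \int[P]_pi g pi.
  rewrite (within_mass_transport t mrM rMinv mQ Qfin Q0).
  rewrite (within_mass_transport t mrm rminv mQ Qfin Q0).
  apply: ge0_le_integral => //.
  - by move=> pi _; apply: integral_ge0 => x _; exact: measure_ge0.
  - exact: (measurable_received (measurable_close_pair t mrM) mQ).
  - exact: (measurable_received (measurable_close_pair t mrm) mQ).
  - move=> pi _; have [m mE] := spm_sigma_finite pi.
    rewrite (receivedE _ mrM mQ mE) (receivedE _ mrm mQ mE).
    apply: ge0_le_integral => //.
    + exact: measurable_received_density.
    + exact: measurable_received_density.
    + move=> xi _.
      have [[Qxi cxi]|nQc] := pselect (Q xi /\ centers pi xi); last first.
        rewrite (_ : [set x | _] = set0) ?measure0//.
        by rewrite -subset0 => x [Qxi [[cxi _ _] _]]; apply: nQc.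
      have Qe (r : spm -> V -> \bar R) : [set x | Q xi /\ close_pair r t (pi, x, xi)] =
          [set x | near (centers pi) (r pi) x xi /\ (edist x xi < t)%R].
        by apply/seteqP; split => x // [].
      rewrite !Qe; apply: leb_near_rmax_rmin => //; exact: centers_locally_finite.
(* Holds because [g] is bounded by [leb Q]; it allows the expectation of [g] to be cancelled. *)
have gfin : \int[P]_pi g pi \is a fin_num.
  rewrite ge0_fin_numE; last by apply: integral_ge0 => pi _; exact: measure_ge0.
  apply: (@le_lt_trans _ _ (\int[P]_pi (leb Q))); last first.
    rewrite integral_cst//= probability_setT mule1.
    by rewrite -ge0_fin_numE.
  apply: ge0_le_integral => // pi _.
  by rewrite le_measure ?inE//; [exact: (mWs _ pi mm)|move=> x []].
have h0 : \int[P]_pi h pi = 0.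
  apply/le_anti; rewrite integral_ge0 ?andbT; last by move=> pi _; exact: measure_ge0.
  move: fleg; rewrite (eq_integral (fun pi => g pi + h pi)); last by move=> pi _.
  rewrite ge0_integralD//.
  by rewrite -[leRHS]adde0 leeD2lE.
have : \int[P]_pi `|h pi| = 0.
  by rewrite -[RHS]h0; apply: eq_integral => pi _; rewrite gee0_abs//; exact: measure_ge0.
move/(ae_eq_integral_abs P measurableT mh); apply: filterS => pi /=; exact.
Qed.

(** Integer balls and rational cutoffs leave countably many null events. Outside them a site is
    served under [rmin] within every distance at which [rmax] serves it, so the two serving
    distances agree, and so do the centers off the bisectors. *)
Lemma ae_near_rmin : {ae P, forall pi, {ae @leb R d, forall x, forall xi,
  near (centers pi) (rM pi) x xi -> near (centers pi) (rm pi) x xi}}.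
Proof.
have : {ae P, forall pi, forall n : nat, forall q : rat, setT q ->
    leb [set x | eball 0 n%:R x /\ within rM (ratr q) (pi, x) /\
      ~ within rm (ratr q) (pi, x)] = 0}.
  apply: ae_foralln => n.
  apply: (ae_countable (P := fun (q : rat) pi => leb [set x | eball 0 n%:R x /\
    within rM (ratr q) (pi, x) /\ ~ within rm (ratr q) (pi, x)] = 0)) => [|q _].
    exact: countableP.
  apply: ae_within_eq; first exact: measurable_eball.
  by rewrite ge0_fin_numE//; exact: eball_lty.
apply: filterS => pi H.
have lf := centers_locally_finite pi.
have : {ae @leb R d, forall x, forall n : nat, forall q : rat, setT q ->
    ~ (eball 0 n%:R x /\ within rM (ratr q) (pi, x) /\ ~ within rm (ratr q) (pi, x))}.
  apply: ae_foralln => n.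
  apply: (ae_countable (P := fun (q : rat) x => ~ (eball 0 n%:R x /\
    within rM (ratr q) (pi, x) /\ ~ within rm (ratr q) (pi, x)))) => [|q _].
    exact: countableP.
  apply: null_set_ae; last exact: H.
  have m : measurable_fun setT (fun x : V => (pi, x)).
    by apply: measurable_fun_pair; [exact: measurable_cst|exact: measurable_id].
  apply: measurableI; first exact: measurable_eball.
  apply: measurableI; first exact: measurable_preimageT m (measurable_within (ratr q) mrM).
  by apply: measurableC; exact: measurable_preimageT m (measurable_within (ratr q) mrm).
apply: filterS2 (ae_generic lf) => x gx nW xi nxi.
have wm t : (edist x xi < t)%R ->
    exists z, near (centers pi) (rm pi) x z /\ (edist x z < t)%R.
  move=> xt; have [q] := rat_in_itvoo xt; rewrite in_itv/= => /andP[xq qt].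
  have [n _ xn] : (\bigcup_n eball (0 : V) n%:R) x by rewrite eball_cover.
  have := nW n q Logic.I => nw.
  have [z [nz zq]] : within rm (ratr q) (pi, x).
    by apply: contrapT => nwm; apply: nw; split => //; split => //; exists xi.
  by exists z; split => //; exact: lt_trans qt.
have [|z [nz _]] := wm (edist x xi + 1)%R; first by rewrite ltrDl.
have [Xz zr _] := nz.
have [Xxi _ _] := nxi.
suff -> : xi = z by [].
apply: (gx) => //; apply/le_anti/andP; split.
  exact: near_le nxi Xz (lt_le_trans zr (rmin_le_rmax d1 alpha0 lf Xz)).
(* The [rmin] center obtained at a distance below [edist x z] would be [z] itself, as [near] centers
   of a generic site are unique. *)
rewrite leNgt; apply/negP => /wm[z' [nz' z'z]].
by move: z'z; rewrite (generic_near gx nz' nz) ltxx.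
Qed.

End comparison.

Theorem theorem3 (R : realType) (d : nat)
    (disp : measure_display) (Omega : measurableType disp)
    (Q : probability Omega R)
    (Pi : {RV Q >-> simple_point_measure R d})
    (lambda alpha : R) :
  (1 <= d)%N -> (0 < lambda)%R -> (0 < alpha)%R ->
  let P : probability (simple_point_measure R d) R := distribution Q Pi in
  translation_invariant P ->
  intensity P = lambda%:E ->
  {ae P, forall pi : simple_point_measure R d,
    (exists psi, is_stable_allocation alpha (spm_support pi) psi) /\
    (forall psi psi',
      is_stable_allocation alpha (spm_support pi) psi ->
      is_stable_allocation alpha (spm_support pi) psi' ->
      {ae lebesgue R d, forall x, psi x = psi' x})} /\
  (exists (D : set (simple_point_measure R d))
      (Psi : simple_point_measure R d -> 'rV[R]_d -> assignment R d),
    [/\ is_factor_allocation P alpha D Psi,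
        isometry_equivariant D Psi &
        {ae P, forall pi : simple_point_measure R d,
          D pi /\ is_stable_allocation alpha (spm_support pi) (Psi pi)}]).
Proof.
move=> d1 lambda0 alpha0 P Pinv Pint.
have aetame : {ae P, forall pi, tame_spm pi}.
  by apply: ae_tame_spm => //; rewrite Pint ltry.
pose Psi (pi : simple_point_measure R d) := alloc (centers pi) (rmax alpha (centers pi)).
have mPsi : measurable_fun setT
    (fun p : simple_point_measure R d * 'rV[R]_d => Psi p.1 p.2).
  exact: (@measurable_alloc R d (fun pi => rmax alpha (centers pi))
    (@measurable_rmax R d alpha alpha0)).
have stPsi (pi : simple_point_measure R d) : tame_spm pi ->
    is_stable_allocation alpha (spm_support pi) (Psi pi).
  move=> tp; rewrite -centersE//; apply: alloc_stable => //; first exact: centers_locally_finite.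
  have m : measurable_fun setT (fun x : 'rV[R]_d => (pi, x)).
    by apply: measurable_fun_pair; [exact: measurable_cst|exact: measurable_id].
  exact: measurableT_comp mPsi m.
have iso : isometry_equivariant (@tame_spm R d) Psi.
  move=> T; split => [pi|pi _ x]; first exact: tame_spm_image.
  have cXi := locally_finite_countable (centers_locally_finite pi).
  by rewrite /Psi centers_image; apply: alloc_image => z; exact: rmax_image.
split.
  apply: filterS2 aetame (ae_near_rmin d1 alpha0 Pinv) => pi tp nn.
  split; first by exists (Psi pi); exact: stPsi.
  move=> psi psi' st st'; rewrite -centersE// in st st'.
  have lf := centers_locally_finite pi.
  apply: filterS2 (stable_ae_unique d1 alpha0 lf nn st) (stable_ae_unique d1 alpha0 lf nn st').
  by move=> x -> ->.
(* The locally finite point measures serve as the domain: a measurable set of full measure,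
   preserved by every isometry. *)
exists (@tame_spm R d), Psi; split => //.
  split.
  - exact: measurable_tame_spm.
  - have mD := @measurable_tame_spm R d.
    have PD0 : P (~` @tame_spm R d) = 0 by apply/(negligibleP _ (measurableC mD)).
    by rewrite -(setCK (@tame_spm R d)) probability_setC ?PD0 ?sube0//; exact: measurableC.
  - by move=> pi /stPsi[].
  - exact: measurable_funS mPsi.
  - by move=> v; exact: iso.
by apply: filterS aetame => pi tp; split => //; exact: stPsi.
Qed.
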